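(* Let $S_n=X_1+\cdots+X_n$ be a sum of independent Bernoulli random variables with $\mathbb{P}(X_j=1)=1-\mathbb{P}(X_j=0)=p_j$, and let $\lambda_k=\sum_{j=1}^np_j^k$, $\lambda=\lambda_1>0$, $\theta=\lambda_2/\lambda$. Let $$P_2(z)=e^{\lambda(z-1)-\lambda_2(z-1)^2/2}.$$ Assume $\theta<1$. Then $$\sum_{m\ge0}\frac{\left(\mathbb{P}(S_n=m)-[z^m]P_2(z)\right)^2}{e^{-\lambda}\frac{\lambda^m}{m!}}\le\frac{\lambda_3^2}{\lambda^3}\left(\frac{\sqrt6\,c_2}{(1-\theta)^2}+\frac{\sqrt{3\theta}}{2\sqrt2(1-\theta)^{5/2}}\right)^2,$$ $$\sum_{m\ge0}\left|\mathbb{P}(S_n=m)-[z^m]P_2(z)\right|\le\frac{\lambda_3}{\lambda^{3/2}}\left(\frac{\sqrt6\,c_2}{(1-\theta)^2}+\frac{\sqrt{3\theta}}{2\sqrt2(1-\theta)^{5/2}}\right),$$ $$\sum_{m\ge0}\left|\mathbb{P}(S_n\le m)-[z^m]\frac{P_2(z)}{1-z}\right|\le\frac{\lambda_3}{\lambda}\left(\frac{\sqrt2\,c_2}{(1-\theta)^{3/2}}+\frac{\sqrt{3\theta}}{4\sqrt2(1-\theta)^2}\right),$$ and for every integer $m\ge0$ $$\left|\mathbb{P}(S_n\le m)-[z^m]\frac{P_2(z)}{1-z}\right|\le\frac{\lambda_3}{\lambda^{3/2}}\sqrt{Z(m)}\left(\frac{\sqrt6\,c_2}{(1-\theta)^2}+\frac{\sqrt{3\theta}}{2\sqrt2(1-\theta)^{5/2}}\right),$$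 $$\left|\mathbb{P}(S_n=m)-[z^m]P_2(z)\right|\le\frac{\lambda_3}{\lambda^2}\sqrt{Z(m)}\left(\frac{2\sqrt6\,c_2}{(1-\theta)^{5/2}}+\frac{\sqrt{15\theta}}{2\sqrt2(1-\theta)^3}\right).$$
   Context: $[z^m]\phi(z)$ denotes the coefficient of $z^m$ in the Taylor expansion of $\phi$ at $0$. The constant is $c_2=\frac12\int_0^1e^{t^2/2}(1-t^2)\,dt$. For an integer $m\ge0$, $Z(m):=\min\{\mathbb{P}(\zeta_\lambda\le m),\mathbb{P}(\zeta_\lambda>m)\}$, where $\zeta_\lambda$ is a Poisson random variable with mean $\lambda$. *)

(* Defs.v *)
From HB Require Import structures.
From mathcomp Require Import all_boot all_order all_algebra.
From mathcomp Require Import all_classical all_reals all_analysis.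

Set Implicit Arguments.
Unset Strict Implicit.
Unset Printing Implicit Defensive.

Import Order.TTheory GRing.Theory Num.Theory.
Import numFieldNormedType.Exports.

Local Open Scope classical_set_scope.
Local Open Scope ring_scope.

Definition mutually_independent {d d' : measure_display} {T : measurableType d}
    {T' : measurableType d'} {R : realType} (P : probability T R)
    {I : finType} (X : I -> {RV P >-> T'}) : Prop :=
  forall (J : {set I}) (B : I -> set T'), (forall i, measurable (B i)) ->
    P [set w | forall i, i \in J -> B i (X i w)] =
    (\prod_(i in J) P (X i @^-1` B i))%E.

(* No range condition: values other than 0 and 1 occur with probability 0. *)
Definition bernoulli_rv {d : measure_display} {T : measurableType d}
    {R : realType} (P : probability T R) (X : {RV P >-> R}) (p : R) : Prop :=
  P [set w | X w = 1] = p%:E /\ P [set w | X w = 0] = (1 - p)%:E.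

Definition prob {d : measure_display} {T : measurableType d} {R : realType}
    (P : probability T R) (A : set T) : R := fine (P A).

(* [z^m] f.  All functions involved are real on the real axis, so that
   differentiating along the real axis gives the complex Taylor coefficients. *)
Definition taylor_coef {R : realType} (m : nat) (f : R -> R) : R :=
  derive1n m f 0 / m`!%:R.

Definition c2 {R : realType} : R :=
  2^-1 * \int[@lebesgue_measure R]_(t in `[0, 1]) (expR (t ^+ 2 / 2) * (1 - t ^+ 2)).

(* The library's [poisson_prob] ignores its second argument; the [0%N] below
   carries no meaning. *)
Definition Zmin {R : realType} (lambda : R) (m : nat) : R :=
  Num.min (fine (poisson_prob lambda 0%N [set k | (k <= m)%N]))
          (fine (poisson_prob lambda 0%N [set k | (m < k)%N])).

Definition P2 {R : realType} (lambda lambda2 z : R) : R :=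
  expR (lambda * (z - 1) - lambda2 * (z - 1) ^+ 2 / 2).

(* Main.v *)
Require Import Defs.
From HB Require Import structures.
From mathcomp Require Import all_boot all_order all_algebra.
From mathcomp Require Import all_classical all_reals all_analysis.
From mathcomp Require Import cyclic separable cyclotomic.
From mathcomp Require Import complex.
From mathcomp Require Import ring lra.

Set Implicit Arguments.
Unset Strict Implicit.
Unset Printing Implicit Defensive.

Import Order.TTheory GRing.Theory Num.Theory.
Import numFieldNormedType.Exports.

Local Open Scope classical_set_scope.
Local Open Scope ring_scope.

(* Put [w = z - 1].  The difference of the two generating functions is
   [exp (lam w) * G w] with
   [G w = prod_j (1 + p_j w) exp (- p_j w) - exp (- lam_2 w^2 / 2) = sum_j c_j w^j],
   so the difference of the two sequences is [sum_j c_j nabla^j pi], where [pi] is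
   the Poisson mass function.  The [nabla^j pi] are orthogonal for the weight
   [1 / pi], with squared norm [j! / lam^j] (Charlier polynomials), and the squared
   norm of the difference is at most [sum_j c_j^2 j! / lam^j].  Bounding [G] on
   circles and integrating the resulting Bessel inequality
   [sum_j c_j^2 s^j <= sup_(|w|^2 = s) |G w|^2] against [lam exp (- lam s) ds]
   controls this sum.  The bound on [G] comes from telescoping the product, from
   [|(1 + z) exp (- z)| <= exp (|z|^2 / 2)], and from
   [(1 + z) exp (- z) - 1 + z^2 / 2 = z^3 / 2 * int_0^1 (1 - t^2) exp (- t z) dt],
   whose modulus is at most [c2 |z|^3 exp (|z|^2 / 2)] because
   [t |z| <= t^2 / 2 + |z|^2 / 2].

   Multiplying [G] by [w], resp. dividing it by [w], corresponds to differencing,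
   resp. summing, the sequence; this gives the remaining norms, and the uniform
   bounds follow by Cauchy-Schwarz on [k <= m] or on [k > m].

   No complex limit is taken: the complex exponential is replaced by its Taylor
   polynomials [exps M], and circle averages by averages over roots of unity. *)

(** * Circle averages and truncated exponentials *)

Section RootsOfUnity.
Variable C : numClosedFieldType.

(** In characteristic [0] the polynomial [X^n - 1] is separable, so it has [n] distinct roots, and
    [n] distinct [n]-th roots of unity include a primitive one. *)
Lemma closed_prim_root_exists n : (0 < n)%N -> exists z : C, n.-primitive_root z.
Proof.
move=> n0; have [rs] := closed_field_poly_normal ('X^n - 1 : {poly C}).
rewrite (monicP (monicXnsubC 1 n0)) scale1r => rsE.
suff /hasP[z _ zP] : has n.-primitive_root rs by exists z.
apply: has_prim_root => //.
- by apply/allP => z; rewrite -root_prod_XsubC -rsE.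
- by rewrite -separable_prod_XsubC -rsE separable_Xn_sub_1 // pnatr_eq0 -lt0n.
- by rewrite -ltnS -(size_prod_XsubC rs id) -rsE size_XnsubC.
Qed.

Lemma norm_prim_root n (z : C) : (0 < n)%N -> n.-primitive_root z -> `|z| = 1.
Proof.
move=> n0 /prim_expr_order zn.
have : `|z| ^+ n = 1 by rewrite -normrX zn normr1.
by move/eqP; rewrite pexpr_eq1 // => /eqP.
Qed.

(** On the unit circle conjugation is inversion, so the terms are powers of [z^i / z^j]: a geometric
    sum that vanishes unless the ratio is [1]. *)
Lemma sum_prim_root n (z : C) (i j : 'I_n) : n.-primitive_root z ->
  \sum_(k < n) (z ^+ k) ^+ i * ((z ^+ k) ^+ j)^* = (i == j)%:R * n%:R.
Proof.
move=> zP; have n0 : (0 < n)%N := prim_order_gt0 zP.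
have nz := norm_prim_root n0 zP.
have z0 : z != 0 by rewrite -normr_gt0 nz.
have zc : z^* = z^-1.
  by apply: (mulfI z0); rewrite divff // -normCK nz expr1n.
have E k : (z ^+ k) ^+ i * ((z ^+ k) ^+ j)^* = (z ^+ i / z ^+ j) ^+ k.
  rewrite -!exprM rmorphXn /= zc exprVn expr_div_n -!exprM.
  by rewrite ![(_ * k)%N]mulnC.
under eq_bigr do rewrite E.
have [->|ij] := eqVneq i j.
  rewrite divff ?expf_neq0 // mul1r.
  by under eq_bigr do rewrite expr1n; rewrite sumr_const card_ord.
set x := _ / _.
have x1 : x != 1.
  apply/eqP => x1; move/eqP: ij; apply; apply/val_inj => /=; apply/eqP.
  have := eq_prim_root_expr zP i j; rewrite !modn_small // => <-.
  by rewrite -subr_eq0 -(divr1 (z^+i)) -x1 /x invf_div mulrCA divff ?expf_neq0 // mulr1 subrr.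
rewrite mul0r; have := subrX1 x n.
have -> : x ^+ n = 1.
  by rewrite /x expr_div_n -!exprM ![(_ * n)%N]mulnC !exprM (prim_expr_order zP) !expr1n divr1.
rewrite subrr => /esym/eqP; rewrite mulf_eq0 subr_eq0 (negbTE x1) /=.
by move=> /eqP.
Qed.

Lemma poly_circle_bessel (g : {poly C}) (r B : C) (J : nat) :
  0 <= r -> (forall w, `|w| = r -> `|g.[w]| <= B) ->
  \sum_(j < J) `|g`_j| ^+ 2 * r ^+ (2 * j) <= B ^+ 2.
Proof.
(* [N] exceeds the size of [g], so no two exponents of [g] agree modulo [N] and Parseval's identity
   over the [N]-th roots of unity is exact; it exceeds [J] so that the sum to be bounded is part of
   it. *)
move=> r0 gB; set N := (maxn J (size g)).+1.
have [z zP] := closed_prim_root_exists (ltn0Sn N.-1).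
have N0 : (0 < N)%N by [].
have nz := norm_prim_root N0 zP.
have gE w : g.[w] = \sum_(j < N) g`_j * w ^+ j.
  by apply: horner_coef_wide; rewrite /N ltnW // ltnS leq_maxr.
have rc : r^* = r by apply/CrealP; rewrite ger0_real.
have P : \sum_(k < N) `|g.[r * z ^+ k]| ^+ 2
    = N%:R * \sum_(j < N) `|g`_j| ^+ 2 * r ^+ (2 * j).
  transitivity (\sum_(k < N) \sum_(i < N) \sum_(j < N)
      (g`_i * (g`_j)^* * r ^+ (i + j)) * ((z ^+ k) ^+ i * ((z ^+ k) ^+ j)^*)).
    apply: eq_bigr => k _; rewrite normCK gE rmorph_sum big_distrlr /=.
    apply: eq_bigr => i _; apply: eq_bigr => j _.
    rewrite !exprMn !(rmorphM, rmorphXn) /= rc exprD.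
    by ring.
  rewrite exchange_big /= mulr_sumr; apply: eq_bigr => i _.
  rewrite exchange_big /=.
  under eq_bigr => j _ do rewrite -mulr_sumr (sum_prim_root _ _ zP).
  rewrite (bigD1 i) //= eqxx mul1r big1 ?addr0; last first.
    by move=> j /negbTE; rewrite eq_sym => ->; rewrite mul0r mulr0.
  by rewrite addnn -mul2n normCK mulrC.
have : \sum_(k < N) `|g.[r * z ^+ k]| ^+ 2 <= N%:R * B ^+ 2.
  rewrite -[X in X%:R]card_ord mulr_natl -sumr_const; apply: ler_sum => k _.
  have : `|g.[r * z ^+ k]| <= B.
    by apply: gB; rewrite normrM normrX nz expr1n mulr1 ger0_norm.
  by move=> h; rewrite ler_sqr // ?nnegrE // (le_trans _ h).
rewrite P ler_pM2l ?ltr0n //; apply: le_trans.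
have JN : (J <= N)%N by rewrite /N ltnW // ltnS leq_maxl.
rewrite -(big_mkord xpredT (fun j => `|g`_j| ^+ 2 * r ^+ (2 * j))).
rewrite -(big_mkord xpredT (fun j => `|g`_j| ^+ 2 * r ^+ (2 * j))).
rewrite (big_cat_nat _ JN) //= lerDl sumr_ge0 // => j _.
by rewrite mulr_ge0 // exprn_ge0.
Qed.

End RootsOfUnity.

Section TruncatedExp.
Variable F : numFieldType.

Definition exps M (x : F) : F := \sum_(k < M) x ^+ k / k`!%:R.

Definition expP M (q : {poly F}) : {poly F} := \sum_(k < M) k`!%:R^-1 *: q ^+ k.

(** The part of [exps M a * exps M b] of total degree at least [M]. Its coefficients are
    nonnegative, so its modulus is controlled by its value at the moduli. *)
Definition exp_tail M (a b : F) : F :=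
  \sum_(k < M) \sum_(l < M | (M <= k + l)%N) a ^+ k * b ^+ l / (k`!%:R * l`!%:R).

Lemma sum_triangle (V : zmodType) (f : nat -> nat -> V) M :
  \sum_(n < M) \sum_(k < n.+1) f k (n - k)%N =
  \sum_(k < M) \sum_(l < M | (k + l < M)%N) f k l.
Proof.
transitivity (\sum_(k < M) \sum_(l < M - k) f k l).
  elim: M => [|M IH]; first by rewrite !big_ord0.
  rewrite big_ord_recr /= IH.
  rewrite [in RHS]big_ord_recr /= subSnn big_ord1.
  rewrite big_ord_recr /= subnn addrA; congr (_ + _).
  rewrite -big_split /=; apply: eq_bigr => k _.
  by rewrite subSn ?(ltnW (ltn_ord k)) // big_ord_recr.
apply: eq_bigr => k _.
rewrite (big_ord_widen M (f k) (leq_subr k M)).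
by apply: eq_bigl => l; rewrite ltn_subRL.
Qed.

(** Binomial theorem on the triangle [k + l < M]; the pairs outside it form the error. Stated for
    polynomials so that evaluation gives [expsM] and comparison of coefficients gives
    [expP_coefM]. *)
Lemma expPM M (a b : {poly F}) : expP M a * expP M b = expP M (a + b)
  + \sum_(k < M) \sum_(l < M | (M <= k + l)%N)
     (k`!%:R * l`!%:R)^-1 *: (a ^+ k * b ^+ l).
Proof.
rewrite /expP mulr_suml.
transitivity (\sum_(k < M) (\sum_(l < M | (k + l < M)%N)
     (k`!%:R * l`!%:R)^-1 *: (a ^+ k * b ^+ l) + \sum_(l < M | (M <= k + l)%N)
     (k`!%:R * l`!%:R)^-1 *: (a ^+ k * b ^+ l) : {poly F})).
  apply: eq_bigr => k _; rewrite mulr_sumr.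
  rewrite (bigID (fun l : 'I_M => (k + l < M)%N)) /=; congr (_ + _).
    by apply: eq_bigr => l _; rewrite -scalerAl -scalerAr scalerA invfM.
  by apply: eq_big => l; [rewrite -leqNgt|move=> _; rewrite -scalerAl -scalerAr scalerA invfM].
rewrite big_split /=; congr (_ + _).
rewrite -(sum_triangle (fun k l => (k`!%:R * l`!%:R)^-1 *: (a ^+ k * b ^+ l))).
apply: eq_bigr => n _; rewrite (addrC a b) exprDn scaler_sumr; apply: eq_bigr => k _.
transitivity (n`!%:R^-1 *: (('C(n, k)%:R : F) *: (b ^+ (n - k) * a ^+ k))); last first.
  by rewrite scaler_nat.
rewrite scalerA [b ^+ _ * _]mulrC; congr (_ *: _).
have kn : (k <= n)%N by rewrite -ltnS ltn_ord.
have := bin_fact kn; move/(congr1 (fun x => x%:R : F)).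
rewrite !natrM => <-.
have h m : (m`!)%:R != 0 :> F by rewrite pnatr_eq0 -lt0n fact_gt0.
have h2 : 'C(n, k)%:R != 0 :> F by rewrite pnatr_eq0 -lt0n bin_gt0.
by rewrite !invfM; field; rewrite !h h2.
Qed.

Lemma horner_expP M (q : {poly F}) w : (expP M q).[w] = exps M q.[w].
Proof.
rewrite /expP /exps horner_sum; apply: eq_bigr => k _.
by rewrite hornerZ horner_exp mulrC.
Qed.

Lemma expsM M (a b : F) : exps M a * exps M b = exps M (a + b) + exp_tail M a b.
Proof.
have := congr1 (fun p : {poly F} => p.[0]) (expPM M a%:P b%:P).
rewrite hornerM hornerD !horner_expP hornerD !hornerC => ->; congr (_ + _).
rewrite horner_sum; apply: eq_bigr => k _; rewrite horner_sum; apply: eq_bigr => l _.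
by rewrite hornerZ hornerM !horner_exp !hornerC mulrC.
Qed.

Lemma norm_exp_tail M (a b : F) : `|exp_tail M a b| <= exp_tail M `|a| `|b|.
Proof.
apply: (le_trans (ler_norm_sum _ _ _)); apply: ler_sum => k _.
apply: (le_trans (ler_norm_sum _ _ _)); apply: ler_sum => l _.
by rewrite normrM normrM !normrX normfV normrM !normr_nat.
Qed.

End TruncatedExp.

Section RealExp.
Variable R : realType.
Implicit Types (x y s rho : R) (M m : nat).

Lemma exps_series M x : exps M x = series (exp_coeff x) M.
Proof. by rewrite /exps /series /= big_mkord. Qed.

Lemma cvg_exps x : (fun M => exps M x) @ \oo --> expR x.
Proof.
have -> : (fun M => exps M x) = series (exp_coeff x).
  by apply/funext => M; rewrite exps_series.
exact: is_cvg_series_exp_coeff.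
Qed.

Lemma exps_nd x M N : 0 <= x -> (M <= N)%N -> exps M x <= exps N x.
Proof.
move=> x0 MN; rewrite /exps -!(big_mkord xpredT (fun k => x ^+ k / k`!%:R)).
rewrite (big_cat_nat _ MN) //= lerDl sumr_ge0 // => k _.
by rewrite divr_ge0 // exprn_ge0.
Qed.

Lemma exps_le_expR x M : 0 <= x -> exps M x <= expR x.
Proof.
move=> x0; have /cvgr_to_ge := @cvg_exps x; apply.
by near=> N; apply: exps_nd => //; near: N; exact: nbhs_infty_ge.
Unshelve. all: by end_near. Qed.

(** For negative [x] the truncation may exceed [expR x], but the terms dropped are dominated by
    those of [s]. *)
Lemma exps_remainder M x s : `|x| <= s ->
  exps M x <= expR x + (expR s - exps M s).
Proof.
move=> xs.
have : (fun N => exps N x + (exps N s - exps M s)) @ \oo -->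
    expR x + (expR s - exps M s).
  apply: cvgD; first exact: cvg_exps.
  by apply: cvgB; [exact: cvg_exps|exact: cvg_cst].
move=> /cvgr_to_ge; apply; near=> N.
have MN : (M <= N)%N by near: N; exact: nbhs_infty_ge.
have eN y : exps N y = exps M y + \sum_(M <= k < N) y ^+ k / k`!%:R.
  by rewrite /exps -!(big_mkord xpredT (fun k => _ ^+ k / k`!%:R)) (big_cat_nat (leq0n M) MN).
rewrite !eN.
suff : - (\sum_(M <= k < N) x ^+ k / k`!%:R) <= \sum_(M <= k < N) s ^+ k / k`!%:R by lra.
rewrite -sumrN; apply: ler_sum => k _; rewrite -mulNr ler_wpM2r //.
have : `|x| ^+ k <= s ^+ k by rewrite lerXn2r // nnegrE (le_trans _ xs).
by rewrite -normrX; apply: le_trans; rewrite -normrN ler_norm.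
Unshelve. all: by end_near. Qed.

Lemma cvg_pow_fact x k : (fun M => x ^+ (M + k) / M`!%:R) @ \oo --> 0.
Proof.
have -> : (fun M => x ^+ (M + k) / M`!%:R) = (fun M => x ^+ k * exp_coeff x M).
  by apply/funext => M; rewrite exprD /exp_coeff /=; ring.
rewrite -[X in _ --> X](mulr0 (x ^+ k)).
by apply: cvgM; [exact: cvg_cst|exact: cvg_exp_coeff].
Qed.

Lemma exp_tail_diag M x : exp_tail M x x = exps M x ^+ 2 - exps M (2 * x).
Proof. by rewrite expr2 expsM mulr_natl mulr2n addrC addKr. Qed.

Lemma exp_tail_ge0 M x : 0 <= x -> 0 <= exp_tail M x x.
Proof.
move=> x0; apply: sumr_ge0 => k _; apply: sumr_ge0 => l _.
by rewrite divr_ge0 ?mulr_ge0 ?exprn_ge0.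
Qed.

(* Bounds [|exps M z|^2 - exp (2 Re z)] from above on the circle [|z| = rho]. *)
Definition exps_err M rho : R :=
  exp_tail M rho rho + (expR (2 * rho) - exps M (2 * rho)).

Lemma exps_err_ge0 M rho : 0 <= rho -> 0 <= exps_err M rho.
Proof.
by move=> r0; rewrite addr_ge0 ?exp_tail_ge0 // subr_ge0 exps_le_expR // mulr_ge0.
Qed.

Lemma cvg_exps_err rho : (fun M => exps_err M rho) @ \oo --> 0.
Proof.
have -> : 0 = expR rho ^+ 2 - expR (2 * rho) + (expR (2 * rho) - expR (2 * rho)).
  by rewrite -expRM_natl subrr addr0.
have E2 := @cvg_exps (2 * rho).
rewrite /exps_err; under eq_fun do rewrite exp_tail_diag.
apply: cvgD; last by apply: cvgB => //; exact: cvg_cst.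
apply: cvgB => //; rewrite expr2; under eq_fun do rewrite expr2.
by apply: cvgM; exact: cvg_exps.
Qed.

End RealExp.

(** * Moduli of truncated complex exponentials *)

Section ComplexExp.
Variable R : realType.
Local Notation C := R[i].
Local Open Scope complex_scope.
Implicit Types (z w : C) (rho p r : R) (M m : nat).

Lemma exps_real_complex M (x : R) : exps M x%:C = (exps M x)%:C.
Proof.
rewrite /exps rmorph_sum /=; apply: eq_bigr => k _.
by rewrite rmorphM rmorphXn fmorphV rmorph_nat.
Qed.

Lemma exp_tail_real_complex M (x : R) :
  exp_tail M x%:C x%:C = (exp_tail M x x)%:C.
Proof.
have := expsM M x%:C x%:C; rewrite -(rmorphD (real_complex R)) !exps_real_complex.
rewrite -(rmorphM (real_complex R)) expsM (rmorphD (real_complex R)).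
by move=> /addrI.
Qed.

Lemma conj_exps M z : Num.conj (exps M z) = exps M (Num.conj z).
Proof.
rewrite /exps rmorph_sum; apply: eq_bigr => k _.
by rewrite rmorphM fmorphV rmorphXn rmorph_nat.
Qed.

Lemma norm_exps (F : numFieldType) M (z : F) : `|exps M z| <= exps M `|z|.
Proof.
apply: (le_trans (ler_norm_sum _ _ _)); apply: ler_sum => k _.
by rewrite normrM normfV normrX normr_nat.
Qed.

(** [exps M] commutes with conjugation, so the squared modulus is [exps M z] times [exps M] at the
    conjugate, that is [exps M (2 Re z)] plus a tail, which is at most its value at [rho]. *)
Lemma normX_exps M z rho : `|z| = rho%:C ->
  `|exps M z| ^+ 2 <= (expR (2 * complex.Re z) + exps_err M rho)%:C.
Proof.
move=> zr; rewrite normCK conj_exps.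
have cz : z + z^* = (2 * complex.Re z)%:C.
  by rewrite (addcJ z) rmorphM rmorph_nat.
have xr : `|2 * complex.Re z| <= 2 * rho.
  rewrite normrM ger0_norm // ler_pM2l // -lecR -zr; exact: normc_ge_Re.
have tl : exp_tail M z z^* <= (exp_tail M rho rho)%:C.
  (* Only real elements of [C] are comparable with their moduli; the tail is a difference of two
     reals. *)
  have tr : exp_tail M z z^* \is Num.real.
    have -> : exp_tail M z z^* = `|exps M z| ^+ 2 - (exps M (2 * complex.Re z))%:C.
      by rewrite -exps_real_complex -cz normCK conj_exps expsM addrC addKr.
    by rewrite rpredB ?rpredX ?normr_real // complex_real.
  apply: (le_trans (real_ler_norm tr)); apply: (le_trans (norm_exp_tail _ _ _)).
  by rewrite norm_conjC zr exp_tail_real_complex.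
rewrite expsM cz exps_real_complex; apply: (le_trans (lerD (lexx _) tl)).
rewrite -rmorphD /= lecR /exps_err; have := exps_remainder M xr; lra.
Qed.

(** With [z = p w], these are the truncated factors of the two products in [G]. *)
Definition phiT M z : C := (1 + z) * exps M (- z).
Definition psiT M z : C := exps M (- (z ^+ 2 / 2)).

Definition phi_bound M rho : R :=
  Num.sqrt (expR (rho ^+ 2) + (1 + rho) ^+ 2 * exps_err M rho).

Lemma cvg_phi_bound rho : (fun M => phi_bound M rho) @ \oo --> expR (rho ^+ 2 / 2).
Proof.
have -> : expR (rho ^+ 2 / 2) = Num.sqrt (expR (rho ^+ 2) + (1 + rho) ^+ 2 * 0).
  rewrite mulr0 addr0 [in RHS](splitr (rho ^+ 2)) expRD -expr2 sqrtr_sqr.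
  by rewrite ger0_norm // expR_ge0.
apply: continuous_cvg; first exact: sqrt_continuous.
apply: cvgD; first exact: cvg_cst.
by apply: cvgM; [exact: cvg_cst|exact: cvg_exps_err].
Qed.

(** With [x = Re z], [|1 + z|^2 = 1 + 2x + rho^2 <= exp (2x + rho^2)], which absorbs the factor
    [exp (- 2x)] of [|exp (- z)|^2] and leaves [exp (rho^2)]. *)
Lemma norm_phiT M z rho : `|z| = rho%:C -> `|phiT M z| <= (phi_bound M rho)%:C.
Proof.
move=> zr; have rho0 : 0 <= rho by rewrite -ler0c -zr.
set x := complex.Re z.
have n1z : `|1 + z| ^+ 2 = (1 + 2 * x + rho ^+ 2)%:C.
  rewrite normCK rmorphD /= rmorph1 mulrDl mul1r mulrDr mulr1 -normCK zr.
  rewrite -!rmorphXn /= addrA -(addrA 1) (addrC z^*) (addcJ z) !rmorphD !rmorphM /=.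
  by rewrite rmorph1 rmorph_nat.
have xr : `|x| <= rho by rewrite -lecR -zr; exact: normc_ge_Re.
have h := normX_exps M (z := - z) (rho := rho); rewrite normrN in h.
have {}h := h zr.
have ReN : complex.Re (- z) = - x by rewrite /x; case: (z).
rewrite ReN in h.
have p0 : 0 <= 1 + 2 * x + rho ^+ 2.
  by rewrite -ler0c -n1z exprn_ge0.
have key : `|phiT M z| ^+ 2 <= (expR (rho ^+ 2) + (1 + rho) ^+ 2 * exps_err M rho)%:C.
  rewrite /phiT normrM exprMn n1z.
  have : (1 + 2 * x + rho ^+ 2)%:C * `|exps M (- z)| ^+ 2 <=
     (1 + 2 * x + rho ^+ 2)%:C * (expR (2 * - x) + exps_err M rho)%:C.
    by rewrite ler_wpM2l // ler0c.
  move=> /le_trans; apply; rewrite -rmorphM /= lecR mulrDr lerD //.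
    have : 1 + (2 * x + rho ^+ 2) <= expR (2 * x + rho ^+ 2) := expR_ge1Dx _.
    rewrite addrA => /(ler_wpM2r (expR_ge0 (2 * - x))) /le_trans; apply.
    by rewrite -expRD; rewrite (_ : 2 * x + rho ^+ 2 + 2 * - x = rho ^+ 2) //; ring.
  apply: ler_wpM2r; first exact: exps_err_ge0.
  by move: xr; rewrite ler_norml => /andP[]; nra.
have X0 : 0 <= expR (rho ^+ 2) + (1 + rho) ^+ 2 * exps_err M rho.
  by rewrite -ler0c (le_trans _ key) // exprn_ge0.
rewrite -(@ler_pXn2r _ 2) // ?nnegrE ?normr_ge0 ?ler0c ?sqrtr_ge0 //.
suff -> : (phi_bound M rho)%:C ^+ 2
    = (expR (rho ^+ 2) + (1 + rho) ^+ 2 * exps_err M rho)%:C by [].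
by rewrite -(rmorphXn (real_complex R)) /phi_bound sqr_sqrtr.
Qed.

End ComplexExp.

(** * The constant c2 *)

Section C2.
Variable R : realType.
Implicit Types (x y s rho t : R) (M m : nat).
Local Notation mu := (@lebesgue_measure R).

(** The primitive of [exps m (t * rho) * (1 - t^2)] in [t] that vanishes at [0]. *)
Definition c2_poly m rho : {poly R} := \sum_(k < m)
  (rho ^+ k / k`!%:R) *: (k.+1%:R^-1 *: 'X^(k.+1) - k.+3%:R^-1 *: 'X^(k.+3)).

Lemma deriv_c2_poly m rho t :
  (c2_poly m rho)^`().[t] = exps m (t * rho) * (1 - t ^+ 2).
Proof.
rewrite /c2_poly raddf_sum /= horner_sum mulr_suml; apply: eq_bigr => k _.
have dX n : (('X^(n.+1))^`()).[t] = n.+1%:R * t ^+ n.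
  by rewrite derivXn hornerMn hornerXn mulr_natl.
rewrite derivZ derivB !derivZ hornerZ hornerD hornerN !hornerZ !dX exprMn.
rewrite ![t ^+ k.+2]exprS ![t ^+ k.+1]exprS.
have h1 : k.+1%:R != 0 :> R by rewrite pnatr_eq0.
have h3 : k.+3%:R != 0 :> R by rewrite pnatr_eq0.
have hf : k`!%:R != 0 :> R by rewrite pnatr_eq0 -lt0n fact_gt0.
have e1 : k.+1%:R = k%:R + 1 :> R by rewrite -addn1 natrD.
have e3 : k.+3%:R = k%:R + 3 :> R by rewrite -addn3 natrD.
rewrite e1 e3 in h1 h3 *.
by field; rewrite hf h1 h3.
Qed.

Lemma c2_poly_at1 m rho :
  (c2_poly m rho).[1] = 2 * \sum_(k < m) k.+2%:R / (k.+3)`!%:R * rho ^+ k.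
Proof.
rewrite /c2_poly horner_sum mulr_sumr; apply: eq_bigr => k _.
rewrite hornerZ hornerD hornerN !hornerZ !hornerXn !expr1n !factS !natrM.
have h1 : k.+1%:R != 0 :> R by rewrite pnatr_eq0.
have h2 : k.+2%:R != 0 :> R by rewrite pnatr_eq0.
have h3 : k.+3%:R != 0 :> R by rewrite pnatr_eq0.
have hf : k`!%:R != 0 :> R by rewrite pnatr_eq0 -lt0n fact_gt0.
have e2 : k.+2%:R = k%:R + 2 :> R by rewrite -addn2 natrD.
have e1 : k.+1%:R = k%:R + 1 :> R by rewrite -addn1 natrD.
have e3 : k.+3%:R = k%:R + 3 :> R by rewrite -addn3 natrD.
rewrite e1 e2 e3 in h1 h2 h3 *.
by field; rewrite hf h1 h2 h3.
Qed.

Let itg01 (f : R -> R) : continuous f -> mu.-integrable `[0, 1] (EFin \o f).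
Proof.
move=> cf; apply: continuous_compact_integrable; first exact: segment_compact.
exact: continuous_subspaceT.
Qed.

(** The left side is a partial sum of the moduli series of [((1 + z) exp (- z) - 1 + z^2 / 2) / z^3]
    at [|z| = rho]. It is half the integral over [[0, 1]] of the derivative of [c2_poly], whose
    integrand is compared pointwise with that of [c2]. *)
Lemma c2_majorant m rho : 0 <= rho ->
  \sum_(k < m) k.+2%:R / (k.+3)`!%:R * rho ^+ k <= c2 * expR (rho ^+ 2 / 2).
Proof.
move=> rho0.
have cexp : continuous (fun t : R => expR (t ^+ 2 / 2) * (1 - t ^+ 2)).
  move=> t; apply: cvgM; last by apply: cvgB; [exact: cvg_cst|exact: exprn_continuous].
  apply: continuous_comp; last exact: continuous_expR.
  by apply: cvgM; [exact: exprn_continuous|exact: cvg_cst].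
have cpol : continuous (horner (c2_poly m rho)^`()) by exact: continuous_horner.
have FTC : \int[mu]_(t in `[0, 1]) (c2_poly m rho)^`().[t] = (c2_poly m rho).[1].
  rewrite /Rintegral (@continuous_FTC2 _ _ (horner (c2_poly m rho))) //=.
  - rewrite [X in _ - X](_ : _ = 0) ?subr0 // /c2_poly horner_sum big1 // => k _.
    by rewrite hornerZ hornerD hornerN !hornerZ !hornerXn !expr0n /= !mulr0 subrr mulr0.
  - exact: continuous_subspaceT.
  - split.
    + by move=> x _; exact: derivable_horner.
    + by apply: cvg_at_right_filter; exact: continuous_horner.
    + by apply: cvg_at_left_filter; exact: continuous_horner.
  - by move=> x _; rewrite derive1E; apply: derive_val.
rewrite c2_poly_at1 in FTC.
have : \int[mu]_(t in `[0, 1]) (c2_poly m rho)^`().[t] <=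
  \int[mu]_(t in `[0, 1]) (expR (rho ^+ 2 / 2) * (expR (t ^+ 2 / 2) * (1 - t ^+ 2))).
  apply: le_Rintegral => //.
  - exact: itg01.
  - by apply: itg01 => t; apply: cvgM; [exact: cvg_cst|exact: cexp].
  - move=> t /=; rewrite in_itv /= => /andP[t0 t1]; rewrite deriv_c2_poly mulrA.
    apply: ler_wpM2r; first by rewrite subr_ge0 expr_le1.
    apply: (le_trans (exps_le_expR _ _)); first by rewrite mulr_ge0.
    (* [t rho <= t^2 / 2 + rho^2 / 2]. *)
    rewrite -expRD ler_expR; have := sqr_ge0 (t - rho); nra.
rewrite FTC RintegralZl //; last exact: itg01.
rewrite /c2; set I := \int[_]_(_ in _) _; set E := expR _; lra.
Qed.

(** Positivity is read off from the majorant with [m = 1] and [rho = 1], whose left side is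
    [2 / 3!]. *)
Lemma c2_gt0 : 0 < @c2 R.
Proof.
have := @c2_majorant 1 1 ler01; rewrite big_ord1 expr1n mulr1 => h.
have : 0 < c2 * expR (1 ^+ 2 / 2) :> R by apply: lt_le_trans h; rewrite divr_gt0.
by rewrite pmulr_lgt0 // expR_gt0.
Qed.

Lemma exps_tail2 m x : 0 <= x ->
  \sum_(k < m) x ^+ k.+2 / (k.+2)`!%:R <= x ^+ 2 / 2 * expR x.
Proof.
move=> x0; apply: (@le_trans _ _ (x ^+ 2 / 2 * exps m x)); last first.
  by rewrite ler_wpM2l ?exps_le_expR // divr_ge0 // exprn_ge0.
rewrite /exps mulr_sumr; apply: ler_sum => k _.
have -> : x ^+ 2 / 2 * (x ^+ k / k`!%:R) = x ^+ k.+2 * (2%:R * k`!%:R)^-1.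
  by rewrite invfM -[k.+2]addn2 exprD; ring.
rewrite ler_wpM2l ?exprn_ge0 // -natrM lef_pV2 ?posrE ?ltr0n ?muln_gt0 ?fact_gt0 //.
rewrite !factS mulnA ler_nat leq_pmul2r ?fact_gt0 //.
exact: (@leq_mul 2 1 k.+2 k.+1).
Qed.

End C2.

(** * Taylor remainders of a single factor *)

Section ComplexMajorants.
Variable R : realType.
Local Notation C := R[i].
Local Open Scope complex_scope.
Let rcD := rmorphD (real_complex R).
Let rcM := rmorphM (real_complex R).
Let rcX := rmorphXn (real_complex R).
Let rcV := fmorphV (real_complex R).
Let rc_sum := rmorph_sum (real_complex R).
Let rc_nat := rmorph_nat (real_complex R).
Implicit Types (z w : C) (rho p r : R) (M m : nat).

Lemma norm_psiT M z rho : `|z| = rho%:C ->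
  `|psiT M z| <= (expR (rho ^+ 2 / 2))%:C.
Proof.
move=> zr; apply: (le_trans (norm_exps _ _)).
have -> : `|- (z ^+ 2 / 2)| = (rho ^+ 2 / 2)%:C.
  by rewrite normrN normrM normfV normrX zr normr_nat rcM rcX rcV rc_nat.
have rho0 : 0 <= rho by rewrite -ler0c -zr.
by rewrite exps_real_complex lecR exps_le_expR // divr_ge0 // exprn_ge0.
Qed.

(** Multiplying the truncated exponential by [1 + z] leaves one unmatched term of top degree,
    [- (- z)^(m+3) / (m+2)!], which the left side cancels. *)
Lemma phiT_taylor m z :
  phiT m.+3 z - 1 + z ^+ 2 / 2 + (- z) ^+ m.+3 / (m.+2)`!%:R =
  - \sum_(k < m) k.+2%:R / (k.+3)`!%:R * (- z) ^+ k.+3.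
Proof.
elim: m => [|m IH].
  rewrite big_ord0 oppr0 /phiT /exps !big_ord_recr big_ord0 /=.
  by rewrite !factS fact0; field.
rewrite big_ord_recr /= opprD -IH /phiT /exps [in LHS]big_ord_recr /=.
set S := \sum_(_ < _) _; rewrite !exprS [(m.+3)`!]factS natrM.
have h2 : m.+3%:R != 0 :> C by rewrite pnatr_eq0.
have hf : (m.+2)`!%:R != 0 :> C by rewrite pnatr_eq0 -lt0n fact_gt0.
have e2 : m.+2%:R = m%:R + 2 :> C by rewrite -addn2 natrD.
have e3 : m.+3%:R = m%:R + 3 :> C by rewrite -addn3 natrD.
rewrite e3 in h2; rewrite e2 e3.
by field; rewrite hf h2.
Qed.

Lemma psiT_taylor m z :
  psiT m.+2 z - 1 + z ^+ 2 / 2 = \sum_(k < m) (- (z ^+ 2 / 2)) ^+ k.+2 / (k.+2)`!%:R.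
Proof.
rewrite /psiT; set u := - _.
have -> : exps m.+2 u = 1 + (u + \sum_(k < m) u ^+ k.+2 / (k.+2)`!%:R).
  by rewrite /exps !big_ord_recl /= expr0 fact0 !divr1.
by rewrite /u; ring.
Qed.

(** The two truncated factors agree up to [1 - z^2 / 2]. The remainder of [(1 + z) exp (- z)]
    contributes [c2 rho^3], that of [exp (- z^2 / 2)] contributes [(rho^2 / 2)^2 / 2 = rho^4 / 8],
    and the last term is the unmatched term of [phiT_taylor]. *)
Definition diff_bound m rho : R :=
  (c2 * rho ^+ 3 + rho ^+ 4 / 8) * expR (rho ^+ 2 / 2) + rho ^+ m.+3 / (m.+2)`!%:R.

Lemma norm_phiT_psiT m z rho : `|z| = rho%:C ->
  `|phiT m.+3 z - psiT m.+3 z| <= (diff_bound m rho)%:C.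
Proof.
move=> zr; have rho0 : 0 <= rho by rewrite -ler0c -zr.
have -> : phiT m.+3 z - psiT m.+3 z =
  - \sum_(k < m) k.+2%:R / (k.+3)`!%:R * (- z) ^+ k.+3
  - \sum_(k < m.+1) (- (z ^+ 2 / 2)) ^+ k.+2 / (k.+2)`!%:R
  - (- z) ^+ m.+3 / (m.+2)`!%:R.
  by rewrite -phiT_taylor -psiT_taylor; ring.
apply: (le_trans (ler_normB _ _)); rewrite /diff_bound.
rewrite rcD lerD //; last first.
  by rewrite normrM normfV normrX normrN zr normr_nat rcM rcX rcV rc_nat.
apply: (le_trans (ler_normB _ _)); rewrite mulrDl rcD lerD //.
  rewrite normrN; apply: (le_trans (ler_norm_sum _ _ _)).
  apply: (@le_trans _ _ (rho ^+ 3 * \sum_(k < m) k.+2%:R / (k.+3)`!%:R * rho ^+ k)%:C).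
    rewrite rcM rc_sum mulr_sumr /=; apply: ler_sum => k _.
    rewrite normrM normrM normfV normrX normrN zr !normr_nat.
    rewrite !(rcM, rcX, rcV, rc_nat) /= -addn3 exprD.
    by rewrite [in leRHS]mulrCA [in leRHS](mulrC (rho%:C ^+ 3)).
  rewrite lecR [c2 * _]mulrC -[leRHS]mulrA.
  by apply: ler_wpM2l; [rewrite exprn_ge0|exact: c2_majorant].
apply: (le_trans (ler_norm_sum _ _ _)).
have -> : rho ^+ 4 / 8 = (rho ^+ 2 / 2) ^+ 2 / 2 by field.
apply: (@le_trans _ _ (\sum_(k < m.+1) (rho ^+ 2 / 2) ^+ k.+2 / (k.+2)`!%:R)%:C).
  rewrite rc_sum /=; apply: ler_sum => k _.
  rewrite normrM normfV normrX normrN normr_nat normrM normrX normfV normr_nat zr.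
  by rewrite rcM rcX rcM rcX !rcV !rc_nat.
by rewrite lecR exps_tail2 // divr_ge0 // exprn_ge0.
Qed.

Lemma cvg_diff_bound rho : (fun m => diff_bound m rho) @ \oo -->
  (c2 * rho ^+ 3 + rho ^+ 4 / 8) * expR (rho ^+ 2 / 2).
Proof.
rewrite -[X in _ --> X]addr0; apply: cvgD; first exact: cvg_cst.
have := @cvg_pow_fact R rho 1; rewrite -(cvg_shiftn 2) /=.
by under eq_fun do rewrite addn2 addn1.
Qed.

End ComplexMajorants.

(** * Power series coefficients of G *)

Section TruncatedCoef.
Variable F : numFieldType.
Implicit Types (p q : {poly F}) (M : nat).

(** Congruence modulo [X^M]. *)
Definition eqcoef M p q := forall j, (j < M)%N -> p`_j = q`_j.

Lemma eqcoefM M p p' q q' : eqcoef M p p' -> eqcoef M q q' ->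
  eqcoef M (p * q) (p' * q').
Proof.
move=> ep eq j jM; rewrite !coefM; apply: eq_bigr => i _.
rewrite ep ?eq //; first exact: leq_ltn_trans (leq_subr _ _) jM.
exact: leq_ltn_trans (leq_ord i) jM.
Qed.

(** The error terms of [expPM] are monomials of degree [d (k + l) >= M]. *)
Lemma expP_coefM M d (a b : F) : (0 < d)%N ->
  eqcoef M (expP M (a *: 'X^d) * expP M (b *: 'X^d)) (expP M ((a + b) *: 'X^d)).
Proof.
move=> d0 j jM; rewrite expPM -scalerDl coefD [X in _ + X](_ : _ = 0) ?addr0 //.
rewrite coef_sum big1 // => k _; rewrite coef_sum big1 // => l Mkl.
rewrite !exprZn -scalerAl -scalerAr -!exprM -exprD -mulnDr !coefZ coefXn.
rewrite (_ : (j == _) = false) ?mulr0 //; apply/negbTE; rewrite neq_ltn.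
by rewrite (leq_trans jM) // (leq_trans Mkl) // leq_pmull.
Qed.

Lemma expP_coef_prod M d (I : Type) (s : seq I) (f : I -> F) : (0 < d)%N ->
  eqcoef M (\prod_(i <- s) expP M (f i *: 'X^d)) (expP M ((\sum_(i <- s) f i) *: 'X^d)).
Proof.
move=> d0; elim: s => [|i s IH] j jM.
  rewrite !big_nil scale0r /expP coef_sum.
  rewrite (bigD1 (Ordinal (leq_ltn_trans (leq0n j) jM))) //= expr0 fact0 invr1 scale1r.
  rewrite big1 ?addr0 // => -[[|k] kM] //= _.
  by rewrite expr0n scaler0 coef0.
rewrite !big_cons -(expP_coefM _ _ d0 jM).
by apply: eqcoefM jM => //; exact: IH.
Qed.

Lemma coef_expP M d (a : F) j : (0 < d)%N -> (j < M)%N ->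
  (expP M (a *: 'X^d))`_j = if (d %| j)%N then a ^+ (j %/ d) / (j %/ d)`!%:R else 0.
Proof.
move=> d0 jM; rewrite /expP coef_sum.
under eq_bigr do rewrite exprZn -exprM !coefZ coefXn.
have [/dvdnP[q jq]|jd] := boolP (d %| j)%N; last first.
  rewrite big1 // => k _; rewrite (_ : (j == _) = false) ?mulr0 //.
  by apply: contraNF jd => /eqP ->; exact: dvdn_mulr.
have qM : (q < M)%N by rewrite (leq_ltn_trans _ jM) // jq leq_pmulr.
rewrite (bigD1 (Ordinal qM)) //= {1}jq mulnC eqxx mulr1 jq mulnK // mulrC.
rewrite big1 ?addr0 // => k kq; rewrite mulnC eqn_mul2l.
rewrite (gtn_eqF d0) /= (_ : (q == k) = false) ?mulr0 //.
by apply: contraNF kq => /eqP qk; apply/eqP/val_inj.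
Qed.

End TruncatedCoef.

(** * The function G: coefficients and bounds on circles *)

Section Product.
Variable R : realType.
Local Notation C := R[i].
Local Open Scope complex_scope.
Implicit Types (p r lam : R) (ps : seq R) (c : nat -> R).
Let rcD := rmorphD (real_complex R).
Let rcB := rmorphB (real_complex R).
Let rcN := rmorphN (real_complex R).
Let rcM := rmorphM (real_complex R).
Let rcX := rmorphXn (real_complex R).
Let rcV := fmorphV (real_complex R).
Let rc_sum := rmorph_sum (real_complex R).
Let rc_nat := rmorph_nat (real_complex R).

(* Coefficients of [w f(w)] in terms of those of [f]. *)
Definition shiftr (V : zmodType) (u : nat -> V) (m : nat) : V :=
  if m is m'.+1 then u m' else 0.

Definition expc lam (j : nat) : R := (- lam) ^+ j / j`!%:R.

(* Coefficients of [prod_p (1 + p w) * exp (- lam w)]. *)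
Fixpoint prodc lam ps : nat -> R :=
  if ps is p :: ps' then fun j => prodc lam ps' j + p * shiftr (prodc lam ps') j
  else expc lam.

(* Coefficients of [exp (- lam w ^ 2 / 2)]. *)
Definition gaussc lam (j : nat) : R :=
  if (2 %| j)%N then (- (lam / 2)) ^+ (j %/ 2) / (j %/ 2)`!%:R else 0.

Definition psum (k : nat) ps : R := \sum_(p <- ps) p ^+ k.

(** The coefficients [c_j] of [G]. *)
Definition diffc ps (j : nat) : R := prodc (psum 1 ps) ps j - gaussc (psum 2 ps) j.

Definition phiP M p : {poly C} := (1 + p%:C *: 'X) * expP M (- p%:C *: 'X^1).
Definition psiP M p : {poly C} := expP M (- (p ^+ 2 / 2)%:C *: 'X^2).

Lemma horner_phiP M p w : (phiP M p).[w] = phiT M (p%:C * w).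
Proof. by rewrite /phiP hornerM hornerD hornerC horner_expP !hornerZ !hornerX mulNr. Qed.

Lemma horner_psiP M p w : (psiP M p).[w] = psiT M (p%:C * w).
Proof.
rewrite /psiP horner_expP hornerZ hornerXn /psiT; congr exps.
by rewrite exprMn mulNr rcM rcX rcV rc_nat; ring.
Qed.

Definition diffP M ps : {poly C} := \prod_(p <- ps) phiP M p - \prod_(p <- ps) psiP M p.

Lemma coef_linear_prod lam ps (q : {poly C}) M :
  (forall j, (j < M)%N -> q`_j = (expc lam j)%:C) ->
  forall j, (j < M)%N -> ((\prod_(p <- ps) (1 + p%:C *: 'X)) * q)`_j = (prodc lam ps j)%:C.
Proof.
move=> qE; elim: ps => [|p ps IH] j jM /=; first by rewrite big_nil mul1r qE.
rewrite big_cons -mulrA mulrDl mul1r -scalerAl coefD coefZ coefXM rcD rcM IH //.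
by case: j jM => [//|j] jM; rewrite /= IH // ltnW.
Qed.

Lemma coef_diffP M ps j : (j < M)%N -> (diffP M ps)`_j = (diffc ps j)%:C.
Proof.
move=> jM; rewrite /diffP coefB /diffc rcB; congr (_ - _).
  rewrite big_split /= (@coef_linear_prod (psum 1 ps) _ _ M) //.
  move=> k kM; rewrite expP_coef_prod // coef_expP // dvd1n divn1 /expc.
  by rewrite rcM rcX rcV rc_nat rcN rc_sum sumrN.
rewrite expP_coef_prod // coef_expP // /gaussc; case: ifP => // _.
rewrite rcM rcX rcV rc_nat rcN sumrN /psum mulr_suml rc_sum.
by [].
Qed.

Definition circle_bound ps r : R :=
  (c2 * psum 3 ps * r ^+ 3 + psum 4 ps * r ^+ 4 / 8) * expR (psum 2 ps * r ^+ 2 / 2).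

Lemma norm_prod_psiP M ps r (w : C) : `|w| = r%:C -> all (>= 0) ps ->
  `|(\prod_(p <- ps) psiP M p).[w]| <= (expR (psum 2 ps * r ^+ 2 / 2))%:C.
Proof.
move=> wr; elim: ps => [_|p ps IH /andP[p0 ps0]].
  by rewrite /psum !big_nil !mul0r expR0 hornerC normr1.
rewrite /psum !big_cons hornerM normrM !mulrDl expRD rcM.
apply: ler_pM => //; last exact: IH.
rewrite horner_psiP (le_trans (@norm_psiT _ _ _ (p * r) _)) //.
  by rewrite normrM wr ger0_norm ?ler0c // rcM.
by rewrite exprMn.
Qed.

(** Induction on the factors: a new factor turns the difference into
    [(phi - psi) * prod psi + phi * diff], and the Gaussian factors [exp (p^2 r^2 / 2)] multiply up.
    For finite [m] the bound contains truncation errors, so only its limit is made explicit. *)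
Lemma norm_diffP ps r : 0 <= r -> all (>= 0) ps ->
  exists2 B : nat -> R, B @ \oo --> circle_bound ps r &
    forall m (w : C), `|w| = r%:C -> `|(diffP m.+3 ps).[w]| <= (B m)%:C.
Proof.
move=> r0; elim: ps => [_|p ps IH /andP[p0 ps0]].
  exists (fun=> 0); last first.
    by move=> m w _; rewrite /diffP !big_nil subrr horner0 normr0.
  by rewrite /circle_bound /psum !big_nil !(mul0r, mulr0, addr0); exact: cvg_cst.
have [B Bl BP] := IH ps0.
exists (fun m => diff_bound m (p * r) * expR (psum 2 ps * r ^+ 2 / 2)
  + phi_bound m.+3 (p * r) * B m).
  have -> : circle_bound (p :: ps) r =
      (c2 * (p * r) ^+ 3 + (p * r) ^+ 4 / 8) * expR ((p * r) ^+ 2 / 2)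
       * expR (psum 2 ps * r ^+ 2 / 2) + expR ((p * r) ^+ 2 / 2) * circle_bound ps r.
    rewrite /circle_bound /psum !big_cons !mulrDl expRD !exprMn; ring.
  apply: cvgD; apply: cvgM => //; [exact: cvg_diff_bound|exact: cvg_cst|].
  have := @cvg_phi_bound R (p * r); rewrite -(cvg_shiftn 3) /=.
  by under eq_fun do rewrite addn3.
move=> m w wr; have pw : `|p%:C * w| = (p * r)%:C.
  by rewrite normrM wr ger0_norm ?ler0c // rcM.
have -> : diffP m.+3 (p :: ps) = (phiP m.+3 p - psiP m.+3 p) * (\prod_(p <- ps) psiP m.+3 p)
   + phiP m.+3 p * diffP m.+3 ps.
  by rewrite /diffP !big_cons; ring.
rewrite hornerD (hornerM (_ - _)) (hornerM (phiP _ _)) rcD.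
apply: (le_trans (ler_normD _ _)); rewrite !normrM !rcM lerD //.
  apply: ler_pM => //.
    by rewrite hornerD hornerN horner_phiP horner_psiP; exact: norm_phiT_psiT.
  exact: norm_prod_psiP.
apply: ler_pM => //; first by rewrite horner_phiP; exact: norm_phiT.
exact: BP.
Qed.

(** Once [m + 3 >= J], the first [J] coefficients of the truncated difference are exactly the [c_j];
    only the real bound still depends on [m] and passes to the limit. *)
Lemma diffc_bessel ps r J : 0 <= r -> all (>= 0) ps ->
  \sum_(j < J) diffc ps j ^+ 2 * r ^+ (2 * j) <= circle_bound ps r ^+ 2.
Proof.
move=> r0 ps0; have [B Bl BP] := norm_diffP r0 ps0.
have : (fun m => B m ^+ 2) @ \oo --> circle_bound ps r ^+ 2.
  by under eq_fun do rewrite expr2; rewrite expr2; exact: cvgM.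
move=> /cvgr_to_ge; apply; near=> m.
have Jm : (J <= m.+3)%N.
  by apply: (@leq_trans m); [near: m; exact: nbhs_infty_ge|rewrite -addn3 leq_addr].
rewrite -lecR rcX; apply: le_trans (poly_circle_bessel J _ (BP m)); last by rewrite ler0c.
rewrite rc_sum; apply: ler_sum => j _; rewrite coef_diffP ?(leq_trans (ltn_ord j)) //.
have -> : `|(diffc ps j)%:C| ^+ 2 = (diffc ps j ^+ 2)%:C.
  by rewrite -normrX -rcX ger0_norm // ler0c sqr_ge0.
by rewrite -(rcX _ r) -rcM.
Unshelve. all: by end_near. Qed.

End Product.

(** * Expansions along nabla^j pi *)

Section Charlier.
Variables (R : realType) (lam : R).
Hypothesis lam0 : 0 < lam.
Implicit Types (u v f g c : nat -> R) (m M j k J : nat).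

Definition pois m : R := expR (- lam) * (lam ^+ m / m`!%:R).

(** The sign is such that [nabla] multiplies the generating function by [z - 1]; [shiftr] supplies
    the value [0] at index [-1]. *)
Definition nabla u m : R := shiftr u m - u m.

Definition npois j : nat -> R := iter j nabla pois.

Arguments npois : simpl never.

(** Up to normalization, the Charlier polynomial of degree [k] in [m]. *)
Definition charlier k m : R := npois k m / pois m.

(* The partial sums of [sum_j c_j nabla^j pois], the sequence whose generating
   function is [exp (lam (z - 1)) * sum_j c_j (z - 1) ^ j]. *)
Definition npsum c J m : R := \sum_(j < J) c j * npois j m.

Definition nexpansion c v := forall m, (fun J => npsum c J m) @ \oo --> v m.

Lemma pois_gt0 m : 0 < pois m.
Proof. by rewrite mulr_gt0 ?expR_gt0 // divr_gt0 ?exprn_gt0 // ltr0n fact_gt0. Qed.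

Lemma poisS m : m.+1%:R * pois m.+1 = lam * pois m.
Proof.
rewrite /pois exprS factS natrM invfM.
have h : m.+1%:R != 0 :> R by rewrite pnatr_eq0.
by rewrite [LHS](_ : _ = (m.+1%:R / m.+1%:R) * (expR (- lam) * (lam * lam ^+ m / m`!%:R)));
  [rewrite divff // mul1r; ring|ring].
Qed.

Lemma npoisS j m : npois j.+1 m = shiftr (npois j) m - npois j m.
Proof. by rewrite /npois iterS. Qed.

(** Coefficient of [z^m] in [d/dz (exp (lam w) w^j) = lam exp (lam w) w^j + j exp (lam w) w^(j-1)];
    for [j = 0] the factor [j] removes the last term. *)
Lemma npois_rec j m :
  m.+1%:R * npois j m.+1 = lam * npois j m + j%:R * npois j.-1 m.
Proof.
elim: j m => [|j IH] m; first by rewrite mul0r addr0 poisS.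
rewrite !npoisS /= mulrBr IH.
suff : m%:R * npois j m = lam * shiftr (npois j) m + j%:R * (npois j m + npois j.-1 m).
  by rewrite -[m.+1]addn1 -[j.+1]addn1 !natrD => h; lra.
case: m => [|m] /=.
  case: j {IH} => [|j] /=; rewrite ?mul0r ?mulr0 ?addr0 //.
  by rewrite npoisS /= sub0r addNr mulr0 addr0.
rewrite IH; congr (_ + _); case: j {IH} => [|j]; first by rewrite !mul0r.
by rewrite /= npoisS /= subrK.
Qed.

Lemma npois0 j : npois j 0 = (-1) ^+ j * expR (- lam).
Proof.
elim: j => [|j IH]; first by rewrite /npois /= /pois expr0 fact0 divr1 mulr1 mul1r.
by rewrite npoisS /= IH exprS; ring.
Qed.

Lemma npsum_rec c K m : m.+1%:R * npsum c K.+1 m.+1 =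
  lam * npsum c K.+1 m + npsum (fun j => j.+1%:R * c j.+1) K m.
Proof.
have -> : npsum (fun j => j.+1%:R * c j.+1) K m =
   \sum_(j < K.+1) j%:R * c j * npois j.-1 m.
  by rewrite big_ord_recl /= !mul0r add0r; apply: eq_bigr.
rewrite /npsum !mulr_sumr -big_split /=; apply: eq_bigr => j _.
by rewrite mulrCA npois_rec; ring.
Qed.

Lemma npsum_shiftr c K m : npsum (shiftr c) K.+1 m = nabla (npsum c K) m.
Proof.
rewrite /npsum big_ord_recl /= mul0r add0r /nabla.
have -> : shiftr (fun m => \sum_(j < K) c j * npois j m) m
    = \sum_(j < K) c j * shiftr (npois j) m.
  by case: m => //=; rewrite big1 // => j _; rewrite mulr0.
rewrite -sumrB; apply: eq_bigr => j _.
by rewrite /bump /= add1n npoisS mulrBr.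
Qed.

Lemma cvg_nabla (w : nat -> nat -> R) v :
  (forall m, (fun J => w J m) @ \oo --> v m) ->
  forall m, (fun J => nabla (w J) m) @ \oo --> nabla v m.
Proof.
move=> wv m; apply: cvgB => //; case: m => [|m] /=; [exact: cvg_cst|exact: wv].
Qed.

Lemma nexpansion_shiftr c v : nexpansion c v -> nexpansion (shiftr c) (nabla v).
Proof.
move=> cv m; rewrite -(cvg_shiftS (fun J => npsum _ J m)) /=.
under eq_fun do rewrite npsum_shiftr.
exact: cvg_nabla.
Qed.

Lemma nexpansionD c c' v v' : nexpansion c v -> nexpansion c' v' ->
  nexpansion (fun j => c j + c' j) (fun m => v m + v' m).
Proof.
move=> cv cv' m.
have -> : (fun J => npsum (fun j => c j + c' j) J m) =
    (fun J => npsum c J m + npsum c' J m).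
  by apply/funext => J; rewrite /npsum -big_split; apply: eq_bigr => j _; rewrite mulrDl.
exact: cvgD.
Qed.

Lemma nexpansionZ a c v : nexpansion c v ->
  nexpansion (fun j => a * c j) (fun m => a * v m).
Proof.
move=> cv m.
have -> : (fun J => npsum (fun j => a * c j) J m) = (fun J => a * npsum c J m).
  by apply/funext => J; rewrite /npsum mulr_sumr; apply: eq_bigr => j _; rewrite mulrA.
by apply: cvgM => //; exact: cvg_cst.
Qed.

(** This is [exp (lam w) exp (- lam w) = 1]. At [m = 0] the sums are those of [exp (- lam) exp lam];
    beyond, [npsum_rec] and [c' = - lam c] leave the difference of two consecutive partial sums at
    the previous index. *)
Lemma nexpansion_expc : nexpansion (expc lam) (fun m => (m == 0%N)%:R).
Proof.
elim=> [|m IH].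
  have -> : (fun J => npsum (expc lam) J 0) = (fun J => expR (- lam) * exps J lam).
    apply/funext => J; rewrite /npsum /exps mulr_sumr; apply: eq_bigr => j _.
    have -> : lam ^+ j = (- lam) ^+ j * (-1) ^+ j by rewrite -exprMn mulrN1 opprK.
    by rewrite npois0 /expc; ring.
  rewrite -[X in _ --> X](expRxMexpNx_1 lam) mulrC.
  by apply: cvgM; [exact: cvg_cst|exact: cvg_exps].
rewrite -(cvg_shiftS (fun J => npsum _ J m.+1)) /=.
have h : m.+1%:R != 0 :> R by rewrite pnatr_eq0.
have -> : (fun J => npsum (expc lam) J.+1 m.+1) =
   (fun J => m.+1%:R^-1 * (lam * (npsum (expc lam) J.+1 m - npsum (expc lam) J m))).
  apply/funext => J; apply: (mulfI h); rewrite mulrA divff // mul1r npsum_rec mulrBr.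
  congr (_ + _); rewrite /npsum mulr_sumr -sumrN; apply: eq_bigr => j _.
  rewrite /expc exprS factS natrM invfM.
  rewrite [LHS](_ : _ = (j.+1%:R / j.+1%:R) * (- (lam * ((- lam) ^+ j / j`!%:R * npois j m))));
    [by rewrite divff ?mul1r // pnatr_eq0|ring].
have -> : (m.+1 == 0%N)%:R = m.+1%:R^-1 * (lam * ((m == 0%N)%:R - (m == 0%N)%:R)) :> R.
  by rewrite subrr !mulr0.
apply: cvgM; first exact: cvg_cst.
apply: cvgM; first exact: cvg_cst.
by apply: cvgB => //; rewrite (cvg_shiftS (fun J => npsum _ J m)).
Qed.

(** Coefficient form of [f' = - l2 w f] for [f = exp (- l2 w^2 / 2)]. *)
Lemma gausscS (l2 : R) j : j.+1%:R * gaussc l2 j.+1 = - l2 * shiftr (gaussc l2) j.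
Proof.
case: j => [|j]; first by rewrite /gaussc /= !mulr0.
rewrite /= /gaussc -[j.+2]addn2 dvdn_addl //.
case: ifP => [/dvdnP[q ->]|_]; last by rewrite !mulr0.
have -> : (q * 2 + 2 = q.+1 * 2)%N by rewrite mulSn addnC.
rewrite !mulnK // exprS factS !natrM invfM.
have h : q.+1%:R != 0 :> R by rewrite pnatr_eq0.
have hf : q`!%:R != 0 :> R by rewrite pnatr_eq0 -lt0n fact_gt0.
have e : q.+1%:R = q%:R + 1 :> R by rewrite -addn1 natrD.
rewrite e in h; rewrite e.
by field; rewrite h hf.
Qed.

(** The partial sums obey, up to a shift of [J], the recursion assumed for [v], so convergence
    propagates from [m = 0]. The induction is strong because [nabla] looks back one further
    index. *)
Lemma nexpansion_gaussc (l2 : R) v : v 0%N = expR (- lam - l2 / 2) ->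
  (forall m, m.+1%:R * v m.+1 = lam * v m - l2 * nabla v m) ->
  nexpansion (gaussc l2) v.
Proof.
move=> v0 vS; elim/ltn_ind => -[_|m IH].
  (* Odd terms vanish and even ones have sign [(-1)^j = 1], so [K] terms amount to [uphalf K] terms
     of an exponential series. *)
  have E K : npsum (gaussc l2) K 0 = expR (- lam) * exps (uphalf K) (- (l2 / 2)).
    rewrite /npsum; under eq_bigr do rewrite npois0 mulrA.
    rewrite -mulr_suml mulrC; congr (_ * _).
    elim: K => [|K IHK]; first by rewrite /exps !big_ord0.
    rewrite big_ord_recr /= IHK /gaussc dvdn2 uphalf_half -signr_odd.
    case: (odd K) => /=; first by rewrite mul0r addr0 add1n.
    by rewrite add0n mulr1 divn2 [RHS]/exps big_ord_recr.
  rewrite v0 expRD; under eq_fun do rewrite E.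
  apply: cvgM; first exact: cvg_cst.
  apply: (@cvg_comp _ _ _ uphalf (fun M => exps M _) _ \oo); last exact: cvg_exps.
  apply/cvgnyPge => A; near=> K.
  have AK : (A.*2 <= K)%N by near: K; exact: nbhs_infty_ge.
  by rewrite -(doubleK A) uphalf_half (leq_trans (half_leq AK)) // leq_addl.
have h : m.+1%:R != 0 :> R by rewrite pnatr_eq0.
have -> : v m.+1 = m.+1%:R^-1 * (lam * v m - l2 * nabla v m).
  by apply: (mulfI h); rewrite mulrA divff // mul1r vS.
rewrite -(cvg_shiftn 2) /=.
have -> : (fun J => npsum (gaussc l2) (J + 2) m.+1) =
   (fun J => m.+1%:R^-1 * (lam * npsum (gaussc l2) J.+2 m - l2 * nabla (npsum (gaussc l2) J) m)).
  apply/funext => J; apply: (mulfI h); rewrite mulrA divff // mul1r addn2 npsum_rec.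
  congr (_ + _); rewrite -npsum_shiftr /npsum mulr_sumr -sumrN; apply: eq_bigr => j _.
  by rewrite gausscS; ring.
apply: cvgM; first exact: cvg_cst.
apply: cvgB; (apply: cvgM; first exact: cvg_cst).
  have := IH m (ltnSn m); rewrite -(cvg_shiftn 2) /=.
  by under eq_fun do rewrite addn2.
apply: cvgB; last exact: IH.
case: (m) IH => [|m'] IH /=; first exact: cvg_cst.
by apply: IH; rewrite ltnW.
Unshelve. all: by end_near. Qed.

(** Multiplying by [1 + p w] sends a sequence [u] to [u + p nabla u], matching the recursion of
    [prodc]. *)
Lemma nexpansion_prodc (ps : seq R) :
  nexpansion (prodc lam ps) (fun m => (\prod_(p <- ps) (1 + p *: ('X - 1)))`_m).
Proof.
elim: ps => [|p ps IH].
  by move=> m; rewrite big_nil coef1; exact: nexpansion_expc.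
move=> m; rewrite big_cons mulrDl mul1r -scalerAl coefD coefZ mulrBl mul1r coefB.
have -> : ('X * \prod_(p <- ps) (1 + p *: ('X - 1)))`_m =
    shiftr (fun m => (\prod_(p <- ps) (1 + p *: ('X - 1)))`_m) m.
  by rewrite coefXM; case: m.
exact: (nexpansionD IH (@nexpansionZ p _ _ (nexpansion_shiftr IH))).
Qed.

(** Division by [w = z - 1]: since [1 / (z - 1) = - sum_k z^k], it turns [v] into minus its partial
    sums, and [c 0 = 0] makes the quotient a power series in [w]. *)
Lemma nexpansion_behead c v : c 0%N = 0 -> nexpansion c v ->
  nexpansion (fun j => c j.+1) (fun m => - \sum_(k < m.+1) v k).
Proof.
move=> c0 cv.
have E J m : npsum c J.+1 m = nabla (npsum (fun j => c j.+1) J) m.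
  rewrite -npsum_shiftr /npsum; apply: eq_bigr => j _.
  by case: j => -[|j] jJ //=; rewrite c0 mul0r.
have cvS m : (fun J => npsum c J.+1 m) @ \oo --> v m.
  by rewrite (cvg_shiftS (fun J => npsum c J m)).
elim=> [|m IH].
  rewrite big_ord1.
  have -> : (fun J => npsum (fun j => c j.+1) J 0) = (fun J => - npsum c J.+1 0).
    by apply/funext => J; rewrite E /nabla /= sub0r opprK.
  exact: cvgN.
rewrite big_ord_recr opprD /=.
have -> : (fun J => npsum (fun j => c j.+1) J m.+1) =
    (fun J => npsum (fun j => c j.+1) J m - npsum c J.+1 m.+1).
  by apply/funext => J; rewrite E /nabla /= opprB addrCA subrr addr0.
exact: cvgB.
Qed.

Lemma charlierS k m :
  charlier k m.+1 = charlier k m + k%:R / lam * charlier k.-1 m.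
Proof.
rewrite /charlier.
have h : m.+1%:R != 0 :> R by rewrite pnatr_eq0.
have l0 : lam != 0 by rewrite gt_eqF.
have p0 : pois m != 0 by rewrite gt_eqF ?pois_gt0.
have -> : pois m.+1 = lam * pois m / m.+1%:R by rewrite -poisS mulrC mulKf.
have -> : npois k m.+1 = (lam * npois k m + k%:R * npois k.-1 m) / m.+1%:R.
  by rewrite -npois_rec mulrC mulKf.
rewrite invfM invrK.
set x := npois _ _; set y := npois _ _.
have -> : (lam * x + k%:R * y) / m.+1%:R * ((lam * pois m)^-1 * m.+1%:R)
  = (lam * x + k%:R * y) / (lam * pois m) * (m.+1%:R / m.+1%:R) by ring.
by rewrite divff // mulr1; field; rewrite l0 p0.
Qed.

(** Induction through [npoisS]: shifting the index costs the ratio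
    [pois m / pois m.+1 = m.+1 / lam]. *)
Lemma charlier_bound k m : `|charlier k m| <= (1 + m%:R / lam) ^+ k.
Proof.
elim: k m => [|k IH] m.
  by rewrite /charlier divff ?normr1 // gt_eqF ?pois_gt0.
have p0 : 0 <= 1 + m%:R / lam by rewrite addr_ge0 // divr_ge0 // ltW.
have p0' : pois m != 0 by rewrite gt_eqF ?pois_gt0.
rewrite /charlier npoisS mulrBl -/(charlier k m).
apply: (le_trans (ler_normB _ _)); rewrite exprS mulrDl mul1r addrC lerD //.
case: m p0 p0' => [|m] p0 p0' /=.
  by rewrite mul0r normr0 !mul0r.
have -> : npois k m / pois m.+1 = m.+1%:R / lam * charlier k m.
  rewrite /charlier.
  have q0 : pois m != 0 by rewrite gt_eqF ?pois_gt0.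
  have l0 : lam != 0 by rewrite gt_eqF.
  have := poisS m; move/(congr1 (fun x => x / (lam * pois m * pois m.+1))).
  rewrite [RHS](_ : _ = (pois m.+1)^-1); last by field; rewrite p0' q0 l0.
  move=> <-; rewrite [LHS](_ : _ = npois k m * (m.+1%:R / (lam * pois m)) * (pois m.+1 / pois m.+1)); last first.
    by rewrite !invfM; ring.
  by rewrite divff // mulr1 invfM; ring.
rewrite normrM ger0_norm ?divr_ge0 ?(ltW lam0) //.
rewrite ler_wpM2l ?divr_ge0 ?(ltW lam0) // (le_trans (IH m)) // lerXn2r ?nnegrE //.
  by rewrite addr_ge0 // divr_ge0 // ltW.
by rewrite lerD2l ler_wpM2r ?invr_ge0 ?(ltW lam0) // ler_nat.
Qed.

(** These are boundary terms of summations by parts. They are at most [pois M * x^n] with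
    [x = 1 + M / lam] and [n = j + k], and [x^n <= n! exp x] turns this into a constant times
    [(lam exp (1 / lam))^M / M!]. *)
Lemma cvg_npois_charlier j k : (fun M => npois j M * charlier k M) @ \oo --> 0.
Proof.
apply: norm_cvg0.
pose b M := expR (- lam) * (j + k)`!%:R * expR 1 * exp_coeff (lam * expR lam^-1) M.
have b0 : b @ \oo --> 0.
  rewrite -[X in _ --> X](mulr0 (expR (- lam) * (j + k)`!%:R * expR 1)).
  by apply: cvgM; [exact: cvg_cst|exact: cvg_exp_coeff].
apply: (@squeeze_cvgr _ _ _ _ (fun=> 0) b) => //; last exact: cvg_cst.
near=> M; rewrite normr_ge0 /= normrM.
have -> : `|npois j M| = pois M * `|charlier j M|.
  rewrite /charlier normrM normfV (gtr0_norm (pois_gt0 M)) mulrCA divff ?mulr1 //.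
  by rewrite gt_eqF ?pois_gt0.
have x0 : 0 <= 1 + M%:R / lam by rewrite addr_ge0 // divr_ge0 // ltW.
rewrite -mulrA; apply: (@le_trans _ _ (pois M * (1 + M%:R / lam) ^+ (j + k))).
  rewrite ler_wpM2l ?(ltW (pois_gt0 _)) // exprD.
  by apply: ler_pM => //; exact: charlier_bound.
have -> : b M = pois M * ((j + k)`!%:R * expR (1 + M%:R / lam)).
  rewrite /b /pois /exp_coeff /= exprMn expRD -(expRM_natl M) [M%:R * _]mulrC.
  by ring.
rewrite ler_wpM2l ?(ltW (pois_gt0 _)) //.
apply: (@le_trans _ _ ((j + k)`!%:R * exps (j + k).+1 (1 + M%:R / lam))); last first.
  by rewrite ler_wpM2l // exps_le_expR.
have f0 : (j + k)`!%:R != 0 :> R by rewrite pnatr_eq0 -lt0n fact_gt0.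
rewrite /exps big_ord_recr /= mulrDr [X in _ <= _ + X]mulrCA divff // mulr1 lerDr.
by apply: mulr_ge0 => //; apply: sumr_ge0 => i _; rewrite divr_ge0 // exprn_ge0.
Unshelve. all: by end_near. Qed.

Lemma sum_nabla f g M : \sum_(m < M) nabla f m * g m =
  \sum_(m < M) f m * (g m.+1 - g m) - shiftr f M * g M.
Proof.
elim: M => [|M IH]; first by rewrite !big_ord0 mul0r subrr.
by rewrite !big_ord_recr /= IH /nabla; ring.
Qed.

(** Summation by parts moves one [nabla] onto [charlier k], where by [charlierS] it lowers [k] and
    yields the factor [k / lam]. At [j = 0] the sum is that of [npois k]: the total Poisson mass for
    [k = 0], a telescoping sum for [k > 0]. *)
Lemma npois_orthogonal j k :
  (fun M => \sum_(m < M) npois j m * charlier k m) @ \oo -->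
  (j == k)%:R * (j`!%:R / lam ^+ j).
Proof.
have B j' k' : (fun M => shiftr (npois j') M * charlier k' M) @ \oo --> 0.
  have -> : (fun M => shiftr (npois j') M * charlier k' M) =
      (fun M => npois j'.+1 M * charlier k' M + npois j' M * charlier k' M).
    by apply/funext => M; rewrite npoisS mulrBl subrK.
  by rewrite -[X in _ --> X]addr0; apply: cvgD; exact: cvg_npois_charlier.
elim: j k => [|j IH] k.
  rewrite fact0 expr0 divr1 mulr1.
  have -> : (fun M => \sum_(m < M) npois 0 m * charlier k m) =
      (fun M => \sum_(m < M) npois k m).
    apply/funext => M; apply: eq_bigr => m _; rewrite /charlier mulrCA divff ?mulr1 //.
    by rewrite gt_eqF ?pois_gt0.
  case: k => [|k] /=.
    have -> : (fun M => \sum_(m < M) npois 0 m) = (fun M => expR (- lam) * exps M lam).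
      by apply/funext => M; rewrite /exps mulr_sumr; apply: eq_bigr.
    rewrite -[X in _ --> X](expRxMexpNx_1 lam) mulrC.
    by apply: cvgM; [exact: cvg_cst|exact: cvg_exps].
  have -> : (fun M => \sum_(m < M) npois k.+1 m) =
      (fun M => - (shiftr (npois k) M * charlier 0 M)).
    apply/funext => M; have := sum_nabla (npois k) (fun=> 1) M.
    rewrite [X in _ = X - _]big1 ?sub0r => [|m _]; last by rewrite subrr mulr0.
    rewrite mulr1 /charlier divff ?mulr1; last by rewrite gt_eqF ?pois_gt0.
    by move=> <-; apply: eq_bigr => m _; rewrite mulr1 npoisS.
  by rewrite -[X in _ --> X]oppr0; exact: cvgN.
have -> : (fun M => \sum_(m < M) npois j.+1 m * charlier k m) =
   (fun M => k%:R / lam * (\sum_(m < M) npois j m * charlier k.-1 m)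
      - shiftr (npois j) M * charlier k M).
  apply/funext => M; rewrite mulr_sumr.
  have := sum_nabla (npois j) (charlier k) M.
  under [in RHS]eq_bigr do rewrite charlierS addrC addKr mulrCA.
  by move=> <-; apply: eq_bigr => m _; rewrite npoisS.
have -> : (j.+1 == k)%:R * (j.+1`!%:R / lam ^+ j.+1) =
   k%:R / lam * ((j == k.-1)%:R * (j`!%:R / lam ^+ j)) - 0.
  rewrite subr0; case: k => [|k] /=; first by rewrite !mul0r.
  rewrite eqSS; case: eqP => [->|_]; last by rewrite !(mul0r, mulr0).
  by rewrite factS natrM exprS invfM; ring.
by apply: cvgB => //; apply: cvgM; [exact: cvg_cst|exact: IH].
Qed.

Lemma cvg_sum_ord n (f : 'I_n -> nat -> R) (l : 'I_n -> R) :
  (forall i, f i @ \oo --> l i) ->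
  (fun M => \sum_(i < n) f i M) @ \oo --> \sum_(i < n) l i.
Proof. by move=> fl; apply: cvg_big => //; exact: add_continuous. Qed.

(** Orthogonality gives equality as [M] tends to infinity, and the sums increase with [M]. *)
Lemma npsum_norm c J M :
  \sum_(m < M) npsum c J m ^+ 2 / pois m <= \sum_(j < J) c j ^+ 2 * (j`!%:R / lam ^+ j).
Proof.
have : (fun N => \sum_(m < N) npsum c J m ^+ 2 / pois m) @ \oo -->
   \sum_(j < J) c j ^+ 2 * (j`!%:R / lam ^+ j).
  have -> : (fun N => \sum_(m < N) npsum c J m ^+ 2 / pois m) =
     (fun N => \sum_(j < J) \sum_(k < J) c j * c k *
        \sum_(m < N) npois j m * charlier k m).
    apply/funext => N.
    under [RHS]eq_bigr do under eq_bigr do rewrite mulr_sumr.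
    under [RHS]eq_bigr do rewrite exchange_big /=.
    rewrite exchange_big /=; apply: eq_bigr => m _.
    rewrite expr2 /npsum big_distrlr /= mulr_suml; apply: eq_bigr => j _.
    by rewrite mulr_suml; apply: eq_bigr => k _; rewrite /charlier; ring.
  have -> : \sum_(j < J) c j ^+ 2 * (j`!%:R / lam ^+ j) =
     \sum_(j < J) \sum_(k < J) c j * c k * ((j == k :> nat)%:R * (j`!%:R / lam ^+ j)).
    apply: eq_bigr => j _; rewrite (bigD1 j) //= eqxx mul1r big1 ?addr0 // => k kj.
    by rewrite (_ : (j == k :> nat) = false) ?mul0r ?mulr0 // eq_sym; exact/negbTE.
  apply: cvg_sum_ord => j; apply: cvg_sum_ord => k.
  by apply: cvgM; [exact: cvg_cst|exact: npois_orthogonal].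
move=> /cvgr_to_ge; apply; near=> N.
have MN : (M <= N)%N by near: N; exact: nbhs_infty_ge.
rewrite -!(big_mkord xpredT (fun m => npsum c J m ^+ 2 / pois m)).
rewrite (big_cat_nat (leq0n M) MN) //= lerDl sumr_ge0 // => m _.
by rewrite divr_ge0 ?sqr_ge0 // ltW ?pois_gt0.
Unshelve. all: by end_near. Qed.

(** A Fatou argument: [J] tends to infinity while the sum over [m] is kept finite. *)
Lemma nexpansion_norm c v (K : R) M : nexpansion c v ->
  (forall J, \sum_(j < J) c j ^+ 2 * (j`!%:R / lam ^+ j) <= K) ->
  \sum_(m < M) v m ^+ 2 / pois m <= K.
Proof.
move=> cv cK.
have : (fun J => \sum_(m < M) npsum c J m ^+ 2 / pois m) @ \oo -->
    \sum_(m < M) v m ^+ 2 / pois m.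
  apply: cvg_sum_ord => m; apply: cvgM; last exact: cvg_cst.
  by under eq_fun do rewrite expr2; rewrite expr2; apply: cvgM; exact: cv.
move=> /cvgr_to_le; apply; near=> J.
exact: le_trans (npsum_norm _ _ _) (cK J).
Unshelve. all: by end_near. Qed.

End Charlier.

(** * Laplace transform of the Bessel inequality *)

Section Laplace.
Variable R : realType.
Implicit Types (a b s : R) (k J : nat).

Lemma is_derive_expR_comp (g : R -> R) (t dg : R) : is_derive t 1 g dg ->
  is_derive t 1 (fun s => expR (g s)) (dg * expR (g t)).
Proof.
by move=> dgt; rewrite mulrC; exact: (is_derive1_comp (is_derive_expR (g t)) dgt).
Qed.

Lemma is_derive_mulf (f g : R -> R) (t df dg : R) :
  is_derive t 1 f df -> is_derive t 1 g dg ->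
  is_derive t 1 (fun s => f s * g s) (f t * dg + g t * df).
Proof. by move=> h1 h2; exact: (is_deriveM h1 h2). Qed.

Lemma is_derive_mull (c t : R) (f : R -> R) (df : R) : is_derive t 1 f df ->
  is_derive t 1 (fun s => c * f s) (c * df).
Proof.
by move=> h; have := is_derive_mulf (is_derive_cst c t 1) h; rewrite mulr0 addr0.
Qed.

(* A primitive of [s ^ k * exp (- a s)] vanishing at infinity. *)
Fixpoint gamma_prim a k : R -> R :=
  if k is k'.+1
  then fun s => - (s ^+ k * expR (- a * s) / a) + k%:R / a * gamma_prim a k' s
  else fun s => - (expR (- a * s) / a).

Lemma is_derive_gamma_prim a k s : a != 0 ->
  is_derive s 1 (gamma_prim a k) (s ^+ k * expR (- a * s)).
Proof.
move=> a0.
have dE (t : R) : is_derive t 1 (fun s => expR (- a * s)) (- a * expR (- a * t)).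
  apply: is_derive_expR_comp.
  by have := is_derive_mull (- a) (is_derive_id t 1); rewrite mulr1.
have dX n (t : R) : is_derive t 1 (fun s => s ^+ n.+1) (n.+1%:R * t ^+ n).
  have := @is_deriveX _ _ id n.+1 t 1 1 (is_derive_id t 1).
  by rewrite exprfctE /GRing.scale /= mulr1.
elim: k => [|k IH] /=.
  have -> : (fun s => - (expR (- a * s) / a)) = (fun s => - a^-1 * expR (- a * s)).
    by apply/funext => t; ring.
  apply: is_derive_eq (is_derive_mull (- a^-1) (dE s)) _.
  by rewrite expr0; field.
have -> : (fun s => - (s ^+ k.+1 * expR (- a * s) / a) + k.+1%:R / a * gamma_prim a k s) =
   (fun s => - a^-1 * (s ^+ k.+1 * expR (- a * s)) + k.+1%:R / a * gamma_prim a k s).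
  by apply/funext => t; ring.
apply: is_derive_eq (is_deriveD (is_derive_mull (- a^-1) (is_derive_mulf (dX k s) (dE s)))
  (is_derive_mull (k.+1%:R / a) IH)) _.
by rewrite exprS; field.
Qed.

Lemma gamma_prim0 a k : a != 0 -> gamma_prim a k 0 = - (k`!%:R / a ^+ k.+1).
Proof.
move=> a0; elim: k => [|k IH] /=; first by rewrite mulr0 expR0 fact0 expr1.
rewrite expr0n /= !mul0r oppr0 add0r IH factS natrM [a ^+ k.+2]exprS.
by field; rewrite a0 expf_neq0.
Qed.

Lemma cvg_Xn_expR a k : 0 < a ->
  (fun n => n%:R ^+ k * expR (- a * n%:R)) @ \oo --> (0 : R).
Proof.
(* Half of the exponent absorbs the power, by [u^k <= k! exp u] with [u = a n / 2], hence the
   constant; the other half decays geometrically. *)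
move=> a0; pose C := k`!%:R * (2 / a) ^+ k.
have b0 : (fun n => C * expR (- (a / 2)) ^+ n) @ \oo --> (0 : R).
  rewrite -[X in _ --> X](mulr0 C); apply: cvgM; first exact: cvg_cst.
  by apply: cvg_expr; rewrite ger0_norm ?expR_ge0 // expR_lt1 oppr_lt0 divr_gt0.
apply: (@squeeze_cvgr _ _ _ _ (fun=> 0) _ _ _ _ _ b0) => //; last exact: cvg_cst.
near=> n; rewrite mulr_ge0 ?expR_ge0 ?exprn_ge0 //= -expRM_natl.
have -> : - a * n%:R = n%:R * - (a / 2) + n%:R * - (a / 2) by field.
rewrite expRD mulrA ler_wpM2r ?expR_ge0 // -ler_pdivlMr ?expR_gt0 //.
rewrite -expRN -mulrN opprK.
have u0 : 0 <= n%:R * (a / 2) by rewrite mulr_ge0 // divr_ge0 // ltW.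
have := exps_le_expR k.+1 u0; rewrite /exps big_ord_recr /=.
set S := \sum_(_ < _) _; have S0 : 0 <= S.
  by apply: sumr_ge0 => i _; rewrite divr_ge0 // exprn_ge0.
move=> h; have {S0}h : (n%:R * (a / 2)) ^+ k / k`!%:R <= expR (n%:R * (a / 2)).
  by apply: le_trans h; rewrite lerDr.
have C0 : 0 < C by rewrite mulr_gt0 ?exprn_gt0 ?divr_gt0 // ltr0n fact_gt0.
rewrite -(ler_pM2l C0) in h; apply: le_trans h.
rewrite /C exprMn [X in X <= _](_ : _ = (k`!%:R / k`!%:R) * ((2 / a) * (a / 2)) ^+ k * n%:R ^+ k).
  by rewrite le_eqVlt; apply/orP; left; apply/eqP; rewrite !exprMn; ring.
rewrite divff ?pnatr_eq0 -?lt0n ?fact_gt0 // (_ : 2 / a * (a / 2) = 1) ?expr1n ?mul1r //.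
by field; rewrite gt_eqF.
Unshelve. all: by end_near. Qed.

Lemma cvg_gamma_prim a k : 0 < a -> (fun n => gamma_prim a k n%:R) @ \oo --> (0 : R).
Proof.
move=> a0; elim: k => [|k IH] /=.
  rewrite -[X in _ --> X]oppr0 -[X in _ --> - X](mul0r a^-1); apply: cvgN.
  apply: cvgM; last exact: cvg_cst.
  have := cvg_Xn_expR 0 a0; by under eq_fun do rewrite expr0 mul1r.
rewrite -[X in _ --> X]addr0; apply: cvgD.
  rewrite -[X in _ --> X]oppr0 -[X in _ --> - X](mul0r a^-1); apply: cvgN.
  by apply: cvgM; [exact: cvg_Xn_expR|exact: cvg_cst].
rewrite -[X in _ --> X](mulr0 (k.+1%:R / a)).
by apply: cvgM => //; exact: cvg_cst.
Qed.

(** [H] is a primitive of the right side minus the left side, so it is nondecreasing on the positive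
    axis; it tends to [0] along the integers, hence [H 0 <= 0]. This integrates the hypothesis over
    the half-line without improper integrals. *)
Lemma laplace_le J (x : nat -> R) a b k (y z : R) : 0 < a -> 0 < b ->
  (forall s, 0 < s -> (\sum_(j < J) x j * s ^+ j) * expR (- b * s) <=
     (y * s ^+ k + z * s ^+ k.+1) * expR (- a * s)) ->
  \sum_(j < J) x j * (j`!%:R / b ^+ j.+1) <=
    y * (k`!%:R / a ^+ k.+1) + z * (k.+1`!%:R / a ^+ k.+2).
Proof.
move=> a0 b0 le_xy.
have an0 : a != 0 by rewrite gt_eqF.
have bn0 : b != 0 by rewrite gt_eqF.
pose H (s : R) := y * gamma_prim a k s + z * gamma_prim a k.+1 s
   - \sum_(j < J) x j * gamma_prim b j s.
have dH (s : R) : is_derive s 1 H ((y * s ^+ k + z * s ^+ k.+1) * expR (- a * s)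
    - (\sum_(j < J) x j * s ^+ j) * expR (- b * s)).
  have dS : is_derive s 1 (fun s => \sum_(j < J) x j * gamma_prim b j s)
      (\sum_(j < J) x j * (s ^+ j * expR (- b * s))).
    have -> : (fun s => \sum_(j < J) x j * gamma_prim b j s) =
        \sum_(j < J) (fun s => x j * gamma_prim b j s).
      by apply/funext => t; rewrite fct_sumE.
    apply: is_derive_sum => j; apply: is_derive_mull; exact: is_derive_gamma_prim.
  apply: is_derive_eq (is_deriveB (is_deriveD
    (is_derive_mull y (is_derive_gamma_prim k s an0))
    (is_derive_mull z (is_derive_gamma_prim k.+1 s an0))) dS) _.
  rewrite mulrDl !mulrA; congr (_ - _).
  by rewrite mulr_suml; apply: eq_bigr => j _; rewrite mulrA.
have H0n n : H 0 <= H n%:R.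
  apply: (@ger0_derive1_ndecry _ H 0) => //.
  - move=> s; rewrite in_itv /= andbT => s0; rewrite derive1E.
    by have := dH s => d; rewrite derive_val subr_ge0 le_xy.
  - by apply: derivable_within_continuous => s _; have [] := dH s.
have cH : (fun n => H n%:R) @ \oo --> (0 : R).
  have -> : 0 = y * 0 + z * 0 - \sum_(j < J) x j * 0 :> R.
    by rewrite !mulr0 big1 ?subr0 ?addr0 // => j _; rewrite mulr0.
  apply: cvgB; first apply: cvgD.
  - by apply: cvgM; [exact: cvg_cst|exact: cvg_gamma_prim].
  - by apply: cvgM; [exact: cvg_cst|exact: cvg_gamma_prim].
  - by apply: cvg_sum_ord => j; apply: cvgM; [exact: cvg_cst|exact: cvg_gamma_prim].
have : H 0 <= 0 by apply: (cvgr_to_ge cH); near=> n; exact: H0n.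
rewrite /H !gamma_prim0 // subr_le0.
under eq_bigr do rewrite gamma_prim0 // mulrN.
by rewrite sumrN !mulrN -opprD lerN2.
Unshelve. all: by end_near. Qed.

(** [tau = B / A] makes the right side the square itself. Splitting a square with a free weight
    [tau] before integrating and optimizing afterwards amounts to Minkowski's inequality. *)
Lemma le_sqrD (x A B : R) : 0 < A -> 0 < B ->
  (forall tau : R, 0 < tau -> x <= (1 + tau) * A ^+ 2 + (1 + tau^-1) * B ^+ 2) ->
  x <= (A + B) ^+ 2.
Proof.
move=> A0 B0 /(_ (B / A) (divr_gt0 B0 A0)) /le_trans; apply.
rewrite le_eqVlt; apply/orP; left; apply/eqP; field.
by rewrite !gt_eqF.
Qed.

(** With [s = r^2], integrating against [lam exp (- lam s)] turns the left side into the weighted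
    sum, while the squared Gaussian factor [exp (lam2 s)] lowers the rate to [lam - lam2 > 0]. *)
Lemma fock_norm_le (c : nat -> R) J k (lam lam2 alpha beta : R) :
  0 < lam -> lam2 < lam -> 0 < alpha -> 0 < beta ->
  (forall r : R, 0 < r -> \sum_(j < J) c j ^+ 2 * r ^+ (2 * j) <=
    ((alpha * r ^+ k + beta * r ^+ k.+1) * expR (lam2 * r ^+ 2 / 2)) ^+ 2) ->
  \sum_(j < J) c j ^+ 2 * (j`!%:R / lam ^+ j) <=
   lam * (alpha * Num.sqrt (k`!%:R / (lam - lam2) ^+ k.+1)
       + beta * Num.sqrt (k.+1`!%:R / (lam - lam2) ^+ k.+2)) ^+ 2.
Proof.
move=> l0 l2l al0 be0 cr.
have a0 : 0 < lam - lam2 by rewrite subr_gt0.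
have q0 n : 0 < n`!%:R / (lam - lam2) ^+ n.+1.
  by rewrite divr_gt0 ?exprn_gt0 // ltr0n fact_gt0.
rewrite -ler_pdivrMl //; apply: le_sqrD; rewrite ?mulr_gt0 ?sqrtr_gt0 // => tau tau0.
rewrite !exprMn !sqr_sqrtr ?(ltW (q0 _)) // ![(1 + _) * (_ ^+ 2 * _)]mulrA.
rewrite mulr_sumr.
have -> : \sum_(j < J) lam^-1 * (c j ^+ 2 * (j`!%:R / lam ^+ j)) =
   \sum_(j < J) c j ^+ 2 * (j`!%:R / lam ^+ j.+1).
  by apply: eq_bigr => j _; rewrite [lam ^+ j.+1]exprS invfM; ring.
apply: (@laplace_le _ (fun j => c j ^+ 2) _ _ _ _ _ a0 l0) => s s0.
have r0 : 0 < Num.sqrt s by rewrite sqrtr_gt0.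
have rs : Num.sqrt s ^+ 2 = s by rewrite sqr_sqrtr // ltW.
have := cr _ r0; under eq_bigr do rewrite exprM rs; rewrite rs => h.
have e1 : expR (- (lam - lam2) * s) = expR (lam2 * s / 2) ^+ 2 * expR (- lam * s).
  by rewrite -expRM_natl -expRD; congr expR; field.
rewrite e1 mulrA ler_wpM2r ?expR_ge0 //; apply: (le_trans h).
rewrite exprMn ler_wpM2r ?sqr_ge0 //.
have rk n : (Num.sqrt s ^+ n) ^+ 2 = s ^+ n by rewrite -exprM mulnC exprM rs.
set u := alpha * _; set v := beta * _.
have -> : (1 + tau) * alpha ^+ 2 * s ^+ k = (1 + tau) * u ^+ 2.
  by rewrite /u exprMn rk; ring.
have -> : (1 + tau^-1) * beta ^+ 2 * s ^+ k.+1 = (1 + tau^-1) * v ^+ 2.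
  by rewrite /v exprMn rk; ring.
(* [(u + v)^2 <= (1 + tau) u^2 + (1 + 1 / tau) v^2], the gap being [tau] times a square. *)
rewrite -subr_ge0 (_ : _ - _ = tau * (u - v / tau) ^+ 2); last by field; rewrite gt_eqF.
by rewrite mulr_ge0 ?sqr_ge0 // ltW.
Qed.

End Laplace.

(** * Taylor coefficients of P2 *)

Section Taylor.
Variable R : realType.
Implicit Types (f : R -> R) (x z l mu : R) (m : nat).

Lemma is_derive_onem z : is_derive z 1 (fun t : R => 1 - t) (-1).
Proof.
by have := is_deriveB (is_derive_cst (1 : R) z 1) (is_derive_id z (1 : R)); rewrite sub0r.
Qed.

(** Leibniz rule for [f' = (l - mu (x - 1)) f]: the first factor is affine, so two terms survive; at
    [m = 0] the second has coefficient [0]. *)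
Lemma P2_derive1n l mu m :
  (forall x, is_derive x 1 (derive1n m (P2 l mu)) (derive1n m.+1 (P2 l mu) x)) /\
  (forall x, derive1n m.+1 (P2 l mu) x =
    (l - mu * (x - 1)) * derive1n m (P2 l mu) x
     - m%:R * mu * derive1n m.-1 (P2 l mu) x).
Proof.
set D := fun m => derive1n m (P2 l mu).
have D' k x (d : R) : is_derive x 1 (D k) d -> D k.+1 x = d.
  by move=> dk; rewrite /D derive1nS derive1E; exact: derive_val.
have dx x : is_derive x 1 (fun t : R => t - 1) 1.
  by have := is_deriveB (is_derive_id x (1 : R)) (is_derive_cst (1 : R) x 1); rewrite subr0.
have d0 x : is_derive x 1 (D 0%N) ((l - mu * (x - 1)) * D 0%N x).
  rewrite {1}/D derive1n0; apply: is_derive_expR_comp.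
  have -> : (fun x => l * (x - 1) - mu * (x - 1) ^+ 2 / 2) =
      (fun x => l * (x - 1) - mu / 2 * ((x - 1) * (x - 1))).
    by apply/funext => t; ring.
  apply: is_derive_eq (is_deriveB (is_derive_mull l (dx x))
    (is_derive_mull (mu / 2) (is_derive_mulf (dx x) (dx x)))) _.
  by field.
(* The recursion involves two consecutive derivatives, so the induction carries the
   differentiability of both. *)
suff H : [/\ forall x, is_derive x 1 (D m) (D m.+1 x),
    forall x, is_derive x 1 (D m.-1) (D m.-1.+1 x) &
    forall x, D m.+1 x = (l - mu * (x - 1)) * D m x - m%:R * mu * D m.-1 x].
  by case: H.
elim: m => [|m [IH1 IH2 IH3]].
  have h0 x : is_derive x 1 (D 0%N) (D 1%N x) by rewrite (D' _ _ _ (d0 x)).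
  split=> // x; rewrite (D' _ _ _ (d0 x)) !mul0r subr0 //.
have dS x : is_derive x 1 (D m.+1) ((l - mu * (x - 1)) * D m.+1 x - m.+1%:R * mu * D m x).
  have -> : D m.+1 = (fun x => (l - mu * (x - 1)) * D m x - m%:R * mu * D m.-1 x).
    by apply/funext.
  have du : is_derive x 1 (fun x => l - mu * (x - 1)) (0 - mu * 1).
    exact: is_deriveB (is_derive_cst l x 1) (is_derive_mull mu (dx x)).
  apply: is_derive_eq (is_deriveB (is_derive_mulf du (IH1 x))
    (is_derive_mull (m%:R * mu) (IH2 x))) _.
  rewrite -IH3; case: (m) => [|k] /=; first by rewrite !mul0r; ring.
  by rewrite -[k.+2]addn1 [in RHS]natrD; ring.
split=> x; [by rewrite (D' _ _ _ (dS x))|exact: IH1|exact: D' (dS x)].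
Qed.

Lemma taylor_P2_0 l mu : taylor_coef 0 (P2 l mu) = expR (- l - mu / 2).
Proof.
by rewrite /taylor_coef derive1n0 fact0 divr1 /P2; congr expR; field.
Qed.

(** At [x = 0] the recursion reads [(l + mu) a_m - mu a_(m-1)]; its [mu] terms are grouped into
    [nabla], the form that [nexpansion_gaussc] expects. *)
Lemma taylor_P2_rec l mu m :
  m.+1%:R * taylor_coef m.+1 (P2 l mu) = l * taylor_coef m (P2 l mu)
   - mu * nabla (fun k => taylor_coef k (P2 l mu)) m.
Proof.
have [_ H] := P2_derive1n l mu m; rewrite /taylor_coef H factS natrM invfM /nabla.
have h : m.+1%:R != 0 :> R by rewrite pnatr_eq0.
rewrite mulrCA [X in _ * X](_ : _ = m`!%:R^-1); last by rewrite mulrA divff ?mul1r.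
case: m {H h} => [|m] /=; first by rewrite !mul0r; ring.
rewrite factS natrM invfM.
have h : m.+1%:R != 0 :> R by rewrite pnatr_eq0.
have hf : m`!%:R != 0 :> R by rewrite pnatr_eq0 -lt0n fact_gt0.
have e : m.+1%:R = m%:R + 1 :> R by rewrite -addn1 natrD.
rewrite e in h; rewrite e.
by field; rewrite hf h.
Qed.

(** For [G = f / (1 - z)], the [k]-th derivatives satisfy [(1 - z) G_k = f_k + k G_(k-1)] on
    [z < 1], away from the pole. At [0], after division by [k!], this says that consecutive
    coefficients of [G] differ by one of [f]. *)
Lemma taylor_geom f m :
  (forall k x, is_derive x 1 (derive1n k f) (derive1n k.+1 f x)) ->
  taylor_coef m (fun z => f z / (1 - z)) = \sum_(k < m.+1) taylor_coef k f.
Proof.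
move=> df; pose G k := derive1n k (fun z => f z / (1 - z)).
have H k : (forall z, z < 1 -> G k z = (derive1n k f z + k%:R * G k.-1 z) / (1 - z)) /\
  (forall z, z < 1 -> is_derive z 1 (G k) (G k.+1 z)).
  suff H : [/\ forall z, z < 1 -> G k z = (derive1n k f z + k%:R * G k.-1 z) / (1 - z),
     forall z, z < 1 -> is_derive z 1 (G k) (G k.+1 z) &
     forall z, z < 1 -> G k.+1 z = (derive1n k.+1 f z + k.+1%:R * G k z) / (1 - z)].
    by case: H.
  have step j : (forall z, z < 1 -> G j z = (derive1n j f z + j%:R * G j.-1 z) / (1 - z)) ->
      (forall z, z < 1 -> is_derive z 1 (fun t => j%:R * G j.-1 t) (j%:R * G j z)) ->
      forall z, z < 1 -> is_derive z 1 (G j) ((derive1n j.+1 f z + j.+1%:R * G j z) / (1 - z)).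
    move=> Gj dGj z z1.
    have nz : 1 - z != 0 by rewrite subr_eq0 eq_sym lt_eqF.
    have dV : is_derive z 1 (fun t : R => (1 - t)^-1) ((1 - z) ^- 2).
      have := is_deriveV (f := fun t : R => 1 - t) nz (is_derive_onem z).
      by rewrite /GRing.scale /= mulrNN mulr1.
    have dE := is_derive_mulf (is_deriveD (df j z) (dGj z z1)) dV.
    have : is_derive z 1 (fun t => (derive1n j f t + j%:R * G j.-1 t) / (1 - t))
       ((derive1n j.+1 f z + j.+1%:R * G j z) / (1 - z)).
      apply: is_derive_eq dE _.
      rewrite [X in X + _](_ : _ = G j z / (1 - z)); last first.
        rewrite Gj // -exprVn.
        rewrite -[(_ + _) z]/(derive1n j f z + j%:R * G j.-1 z).
        by rewrite expr2 mulrA.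
      have -> : j.+1%:R = j%:R + 1 :> R by rewrite -addn1 natrD.
      by field.
    apply: near_eq_is_derive.
    near=> t; rewrite Gj //.
    by near: t; exact: lt_nbhsl.
  elim: k => [|k [IH1 IH2 IH3]].
    have G0 z : z < 1 -> G 0%N z = (derive1n 0 f z + 0%:R * G 0%N z) / (1 - z).
      by rewrite mul0r addr0 /G !derive1n0.
    have dG0 z : z < 1 -> is_derive z 1 (G 0%N) ((derive1n 1 f z + 1%:R * G 0%N z) / (1 - z)).
      move=> z1; apply: step => // t t1.
      have -> : (fun t => 0%:R * G 0%N t) = cst 0 by apply/funext => s; rewrite mul0r.
      by rewrite mul0r; exact: is_derive_cst.
    have E z : z < 1 -> G 1%N z = (derive1n 1 f z + 1%:R * G 0%N z) / (1 - z).
      by move=> z1; rewrite {1}/G derive1nS derive1E; have := dG0 z z1 => h; exact: derive_val.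
    by split=> z z1; [exact: G0|rewrite (E _ z1); exact: dG0|exact: E].
  have dGS z : z < 1 -> is_derive z 1 (G k.+1)
      ((derive1n k.+2 f z + k.+2%:R * G k.+1 z) / (1 - z)).
    move=> z1; apply: step => // t t1; apply: is_derive_mull; exact: IH2.
  have E z : z < 1 -> G k.+2 z = (derive1n k.+2 f z + k.+2%:R * G k.+1 z) / (1 - z).
    by move=> z1; rewrite {1}/G derive1nS derive1E; have := dGS z z1 => h; exact: derive_val.
  by split=> z z1; [exact: IH3|rewrite (E _ z1); exact: dGS|exact: E].
have GE k : G k 0 = derive1n k f 0 + k%:R * G k.-1 0.
  by have [-> //] := H k; rewrite subr0 divr1.
rewrite /taylor_coef -/(G m); elim: m => [|m IH].
  by rewrite big_ord1 GE mul0r addr0.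
rewrite big_ord_recr -IH (GE m.+1) [RHS]addrC mulrDl; congr (_ + _).
by rewrite factS natrM invfM mulrACA divff ?mul1r // pnatr_eq0.
Unshelve. all: by end_near. Qed.

End Taylor.

(** * Sums of independent Bernoulli variables *)

Section BernoulliSum.
Variables (R : realType) (d : measure_display) (T : measurableType d).
Variables (P : probability T R) (n : nat) (X : 'I_n -> {RV P >-> R}) (p : 'I_n -> R).
Hypothesis X_bernoulli : forall j, bernoulli_rv (X j) (p j).
Hypothesis X_independent : mutually_independent X.
Implicit Types (A : {set 'I_n}) (B : set R).

Lemma bernoulli_p01 j : 0 <= p j <= 1.
Proof.
have [h1 h0] := X_bernoulli j.
rewrite -!lee_fin -h1 measure_ge0 /=.
apply: probability_le1.
exact: (measurable_funPTI (X j) (measurable_set1 (1 : R))).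
Qed.

Definition atom A : set T := [set w | forall i, X i w = (i \in A)%:R].

Definition atom_weight A : R := \prod_(i < n) if i \in A then p i else 1 - p i.

Lemma atom_bigcap A :
  atom A = [set w | forall i, i \in [set: 'I_n]%SET -> [set (i \in A)%:R : R] (X i w)].
Proof.
by apply/seteqP; split=> w /= h i; [rewrite h|apply: h; rewrite inE].
Qed.

Lemma measurable_atom A : measurable (atom A).
Proof.
have -> : atom A = \bigcap_(i in [set: 'I_n]) (X i @^-1` [set (i \in A)%:R]).
  by apply/seteqP; split=> w /= h i; [move=> _; rewrite /= h|have := h i I].
by apply: fin_bigcap_measurable => // i _; exact: (measurable_funPTI (X i) (measurable_set1 _)).
Qed.

Lemma prob_atom A : P (atom A) = (atom_weight A)%:E.
Proof.
rewrite atom_bigcap (X_independent [set: 'I_n]%SET (B := fun i => [set (i \in A)%:R])) //.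
rewrite /atom_weight -prodEFin; apply: eq_big => [i|i _]; first by rewrite inE.
have [h1 h0] := X_bernoulli i.
by case: ifP => _; [exact: h1|exact: h0].
Qed.

Lemma sum_atom_weight : \sum_A atom_weight A = 1.
Proof.
transitivity (\prod_(i < n) (p i + (1 - p i))).
  by rewrite bigA_distr; apply: eq_bigl => A; rewrite inE.
by rewrite big1 // => i _; rewrite addrC subrK.
Qed.

Lemma atom_weight_le (E : set T) (Q : pred {set 'I_n}) : measurable E ->
  (forall A, Q A -> atom A `<=` E) -> ((\sum_(A | Q A) atom_weight A)%:E <= P E)%E.
Proof.
move=> mE QE; pose D := [set` enum Q].
have D_Q A : D A -> Q A by rewrite /D /= mem_enum.
apply: (@le_trans _ _ (P (\bigcup_(A in D) atom A))).
  rewrite measure_fin_bigcup //; last by move=> A _; exact: measurable_atom.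
    rewrite /D -fsbig_seq ?enum_uniq // big_enum /= -sumEFin.
    by rewrite le_eqVlt; apply/orP; left; apply/eqP; apply: eq_bigr => A _; rewrite prob_atom.
    exact: finite_finset.
  move=> A A' _ _ [w [wA wA']]; apply/setP => i.
  have := wA i; rewrite wA' => /eqP; rewrite eqr_nat.
  by case: (i \in A); case: (i \in A').
apply: le_measure; rewrite ?inE //.
  by apply: fin_bigcup_measurable => [|A _]; [exact: finite_finset|exact: measurable_atom].
by move=> w [A /D_Q /QE]; exact.
Qed.

(** The atoms inside [E] bound its probability from below, the others that of its complement. All
    weights sum to [1], so both bounds are equalities; this handles the null set on which some [X i]
    is neither [0] nor [1]. *)
Lemma prob_atoms (E : set T) (Q : pred {set 'I_n}) : measurable E ->
  (forall A, Q A -> atom A `<=` E) -> (forall A, ~~ Q A -> atom A `<=` ~` E) ->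
  prob P E = \sum_(A | Q A) atom_weight A.
Proof.
move=> mE QE QC; have h1 := atom_weight_le mE QE.
have h2 := atom_weight_le (measurableC mE) QC.
rewrite probability_setC // in h2.
have [e Ee] : exists e, P E = e%:E.
  by exists (fine (P E)); rewrite fineK // fin_num_measure.
rewrite /prob Ee /= in h1 h2 *; rewrite -EFinB !lee_fin in h1 h2.
have := sum_atom_weight; rewrite (bigID Q) /=; lra.
Qed.

Let S (w : T) : R := \sum_(j < n) X j w.

Lemma measurable_S (B : set R) : measurable B -> measurable (S @^-1` B).
Proof.
have mS : measurable_fun setT S by apply: measurable_sum => j; exact: measurable_funPT.
by move=> mB; rewrite -[X in measurable X]setTI; exact: mS.
Qed.

Lemma S_atom A w : atom A w -> S w = #|A|%:R.
Proof.
move=> wA; rewrite /S; under eq_bigr do rewrite wA.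
by rewrite -natr_sum -sum1_card [in RHS]big_mkcond; congr (_%:R).
Qed.

Definition pgf : {poly R} := \prod_(i < n) (1 + p i *: ('X - 1)).

Lemma coef_pgf m : pgf`_m = \sum_(A : {set 'I_n} | #|A| == m) atom_weight A.
Proof.
have -> : pgf = \sum_A atom_weight A *: 'X^#|A|.
  rewrite /pgf; under eq_bigr => i _.
    rewrite (_ : _ + _ = p i *: 'X + (1 - p i)%:P); last first.
      by rewrite scalerBr alg_polyC rmorphB /=; ring.
    over.
  rewrite bigA_distr; apply: eq_big => [A|A _]; first by rewrite inE.
  transitivity (\prod_(i < n) ((if i \in A then p i else 1 - p i)%:P * (if i \in A then 'X else 1))).
    by apply: eq_bigr => i _; case: ifP => _; [rewrite mul_polyC|rewrite mulr1].
  rewrite big_split /= -rmorph_prod mul_polyC -big_mkcond /= prodr_const.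
  by [].
rewrite coef_sum (bigID (fun A : {set 'I_n} => #|A| == m)) /= [X in _ + X]big1 ?addr0.
  by apply: eq_bigr => A /eqP Am; rewrite coefZ coefXn Am eqxx mulr1.
by move=> A Am; rewrite coefZ coefXn eq_sym (negbTE Am) mulr0.
Qed.

Lemma prob_S_eq m : prob P [set w | S w = m%:R] = pgf`_m.
Proof.
rewrite coef_pgf; apply: prob_atoms.
- exact: (measurable_S (measurable_set1 m%:R)).
- by move=> A /eqP Am w wA /=; rewrite (S_atom wA) Am.
- by move=> A Am w wA /=; rewrite (S_atom wA) => /eqP; rewrite eqr_nat; exact/negP.
Qed.

Lemma prob_S_le m : prob P [set w | S w <= m%:R] = \sum_(k < m.+1) pgf`_k.
Proof.
transitivity (\sum_(A : {set 'I_n} | (#|A| <= m)%N) atom_weight A).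
  apply: prob_atoms.
  - have := measurable_S (measurable_itv `]-oo, m%:R]).
    by rewrite (_ : S @^-1` _ = [set w | S w <= m%:R]) //; apply/seteqP; split=> w /=; rewrite in_itv.
  - by move=> A Am w wA /=; rewrite (S_atom wA) ler_nat.
  - by move=> A Am w wA /=; rewrite (S_atom wA) ler_nat; exact/negP.
under [RHS]eq_bigr do rewrite coef_pgf.
rewrite (exchange_big_dep (fun A : {set 'I_n} => (#|A| <= m)%N)) /=; last first.
  by move=> i A _ /eqP ->; rewrite -ltnS.
by apply: eq_bigr => A Am; rewrite (big_pred1 (Ordinal (Am : (#|A| < m.+1)%N))).
Qed.

End BernoulliSum.

(** * Cauchy-Schwarz for the Poisson weight *)

Section CauchySchwarz.
Variables (R : realType) (lam : R).
Hypothesis lam0 : 0 < lam.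
Local Notation pois := (pois lam).
Implicit Types (e v : nat -> R) (K z : R).

Lemma sum_pois_le1 M : \sum_(m < M) pois m <= 1.
Proof.
rewrite -(expRxMexpNx_1 lam) mulrC /pois -mulr_sumr ler_wpM2l ?expR_ge0 //.
exact: exps_le_expR (ltW lam0).
Qed.

Lemma sum_norm_le (s : seq nat) v K z : 0 < K -> 0 < z ->
  \sum_(m <- s) v m ^+ 2 / pois m <= K ^+ 2 -> \sum_(m <- s) pois m <= z ->
  \sum_(m <- s) `|v m| <= K * Num.sqrt z.
Proof.
(* This [t] balances [2 |v| <= t v^2 / pois + pois / t]: after summation each side contributes
   [K sqrt z / 2]. *)
move=> K0 z0 vK pz; have s0 : 0 < Num.sqrt z by rewrite sqrtr_gt0.
pose t := Num.sqrt z / K; have t0 : 0 < t by rewrite divr_gt0.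
apply: (@le_trans _ _ (\sum_(m <- s) (t / 2 * (v m ^+ 2 / pois m) + t^-1 / 2 * pois m))).
  apply: ler_sum => m _; have p0 := pois_gt0 lam0 m.
  rewrite -subr_ge0 -[v m ^+ 2]real_normK ?num_real //.
  rewrite (_ : _ - _ = (t * `|v m| - pois m) ^+ 2 / (2 * t * pois m)); last first.
    by field; rewrite !gt_eqF.
  by apply: divr_ge0; [exact: sqr_ge0|apply: ltW; apply: mulr_gt0 => //; exact: mulr_gt0].
rewrite big_split /= -mulr_sumr -[X in _ + X <= _]mulr_sumr.
apply: (@le_trans _ _ (t / 2 * K ^+ 2 + t^-1 / 2 * z)).
  have t1 : 0 <= t / 2 by rewrite divr_ge0 // ltW.
  have t2 : 0 <= t^-1 / 2 by rewrite divr_ge0 // invr_ge0 ltW.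
  by apply: lerD; apply: ler_wpM2l.
rewrite -[X in _ + _ * X <= _](sqr_sqrtr (ltW z0)) /t le_eqVlt; apply/orP; left; apply/eqP.
by field; rewrite !gt_eqF.
Qed.

Lemma eseries_le (f : nat -> R) K : (forall m, 0 <= f m) ->
  (forall M, \sum_(m < M) f m <= K) -> (\sum_(0 <= m <oo) (f m)%:E <= K%:E)%E.
Proof.
move=> f0 fK; apply: lime_le.
  by apply: is_cvg_nneseries => m _ _; rewrite lee_fin.
by near=> M; rewrite sumEFin lee_fin big_mkord.
Unshelve. all: by end_near. Qed.

Lemma poisson_le m :
  fine (poisson_prob lam 0%N [set k | (k <= m)%N]) = \sum_(k < m.+1) pois k.
Proof.
rewrite /poisson_prob lam0.
have -> : [set k | (k <= m)%N] = `I_m.+1 by [].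
rewrite esum_fset; last 2 first.
- exact: finite_II.
- by move=> k _; rewrite lee_fin poisson_pmf_ge0.
rewrite -(fsbig_ord _ _ (fun k => (poisson_pmf lam k)%:E)) sumEFin /=.
by apply: eq_bigr => k _; rewrite /poisson_pmf lam0 mulrC.
Qed.

Lemma poisson_gt m :
  fine (poisson_prob lam 0%N [set k | (m < k)%N]) = 1 - \sum_(k < m.+1) pois k.
Proof.
rewrite -poisson_le.
have -> : [set k | (m < k)%N] = ~` [set k | (k <= m)%N].
  by apply/seteqP; split=> k /=; rewrite ltnNge => /negP.
have := @probability_setC _ _ R (poisson_prob lam 0%N) [set k | (k <= m)%N].
move=> -> //; rewrite fineB // fin_num_measure //.
Qed.

(** [e m] is the sum of [v] over [k <= m] and, as [e] tends to [0], also minus the sum over [k > m].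
    Cauchy-Schwarz is applied on whichever range has the smaller Poisson mass. *)
Lemma Zmin_bound e v K m : 0 < K -> (forall m, e m = shiftr e m + v m) ->
  e @ \oo --> 0 -> (forall M, \sum_(m < M) v m ^+ 2 / pois m <= K ^+ 2) ->
  `|e m| <= K * Num.sqrt (Zmin lam m).
Proof.
move=> K0 ev e0 vK.
have eE k : e k = \sum_(i < k.+1) v i.
  elim: k => [|k IH]; first by rewrite ev big_ord1 /= add0r.
  by rewrite ev big_ord_recr -IH.
have p0 := pois_gt0 lam0.
have vp0 k : 0 <= v k ^+ 2 / pois k by rewrite divr_ge0 ?sqr_ge0 // ltW.
rewrite /Zmin poisson_le poisson_gt /Num.min; case: ifP => _.
  rewrite eE; apply: (le_trans (ler_norm_sum _ _ _)).
  rewrite -(big_mkord xpredT (fun i => `|v i|)).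
  apply: sum_norm_le => //; rewrite ?big_mkord //.
  rewrite big_ord_recr /= ltr_wpDl // sumr_ge0 // => k _; exact: ltW.
(* The tail is cut at a finite [M], sent to infinity at the end. *)
have tail M : (m < M)%N -> `|e m - e M| <= K * Num.sqrt (1 - \sum_(k < m.+1) pois k).
  move=> mM; have lt1 : (m.+1 <= M.+1)%N by rewrite ltnW.
  have -> : e m - e M = - \sum_(m.+1 <= k < M.+1) v k.
    rewrite !eE -!(big_mkord xpredT v) (big_cat_nat (leq0n m.+1) lt1) /= opprD.
    by rewrite addNKr.
  rewrite normrN; apply: (le_trans (ler_norm_sum _ _ _)).
  have pM : \sum_(m.+1 <= k < M.+1) pois k <= 1 - \sum_(k < m.+1) pois k.
    have := sum_pois_le1 M.+1; rewrite -!(big_mkord xpredT pois).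
    by rewrite (big_cat_nat (leq0n m.+1) lt1) /= => h; rewrite lerBrDl.
  apply: sum_norm_le => //.
    apply: (lt_le_trans _ pM); rewrite big_nat_recr /=; last exact: mM.
    by rewrite ltr_wpDl // sumr_ge0 // => k _; exact: ltW.
  have := vK M.+1; rewrite -(big_mkord xpredT (fun k => v k ^+ 2 / pois k)).
  by rewrite (big_cat_nat (leq0n m.+1) lt1) /=; apply: le_trans; rewrite lerDr sumr_ge0.
have : (fun M => `|e m - e M|) @ \oo --> `|e m - 0|.
  by apply: cvg_norm; apply: cvgB => //; exact: cvg_cst.
rewrite subr0 => /cvgr_to_le; apply; near=> M; apply: tail.
by near: M; exact: nbhs_infty_gt.
Unshelve. all: by end_near. Qed.

(** Each single term gives [v m ^ 2 <= K * pois m], which tends to [0]. *)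
Lemma cvg0_pois_norm v K : 0 < K ->
  (forall M, \sum_(m < M) v m ^+ 2 / pois m <= K) -> v @ \oo --> 0.
Proof.
move=> K0 vK; have p0 := pois_gt0 lam0.
have q0 : (fun m => Num.sqrt (K * pois m)) @ \oo --> 0.
  rewrite -[X in _ --> X]sqrtr0.
  apply: continuous_cvg; first exact: sqrt_continuous.
  rewrite -[X in _ --> X](mulr0 K); apply: cvgM; first exact: cvg_cst.
  rewrite -[X in _ --> X](mulr0 (expR (- lam))).
  by apply: cvgM; [exact: cvg_cst|exact: cvg_exp_coeff].
apply: norm_cvg0.
apply: (@squeeze_cvgr _ _ _ _ (fun=> 0) _ _ _ _ _ q0) => //; last exact: cvg_cst.
near=> m; rewrite normr_ge0 /= -sqrtr_sqr ler_wsqrtr // -ler_pdivrMr //.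
have := vK m.+1; rewrite big_ord_recr /=; apply: le_trans.
by rewrite lerDr sumr_ge0 // => k _; rewrite divr_ge0 ?sqr_ge0 // ltW.
Unshelve. all: by end_near. Qed.

End CauchySchwarz.

(** * Norm estimates *)

Section Estimates.
Variables (R : realType) (ps : seq R).
Hypothesis ps_ge0 : all (>= 0) ps.
Local Notation lam := (psum 1 ps).
Local Notation lam2 := (psum 2 ps).
Local Notation lam3 := (psum 3 ps).
Hypothesis lam_gt0 : 0 < lam.
Hypothesis lam2_lt : lam2 < lam.

Lemma diff_const_gt0 (a b x y u v : R) : 0 < a -> 0 < b -> 0 < x -> 0 < y ->
  0 <= u -> 0 <= v -> 0 < a / b * (x / y + u / v).
Proof.
move=> a0 b0 x0 y0 u0 v0; rewrite mulr_gt0 ?divr_gt0 // ltr_pwDl ?divr_gt0 //.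
exact: divr_ge0.
Qed.

Lemma psum_gt0 (s : seq R) k : all (>= 0) s -> 0 < psum 1 s -> 0 < psum k s.
Proof.
elim: s => [_|q s IH /andP[q0 s0]]; first by rewrite /psum big_nil ltxx.
have pk0 : 0 <= psum k s.
  rewrite /psum big_seq; apply: sumr_ge0 => x xs; rewrite exprn_ge0 //.
  exact: (allP s0).
rewrite /psum !big_cons expr1; move: q0; rewrite le_eqVlt => /orP[/eqP <-|q0 _].
  by rewrite add0r => /(IH s0) h; rewrite ltr_wpDl // exprn_ge0.
by rewrite ltr_pwDl // exprn_gt0.
Qed.

(** The coefficients of [r^3] and [r^4] in [circle_bound] once [psum 4 ps] is bounded by
    [psum4_le]. *)
Let alpha := c2 * lam3.
Let beta := lam3 * Num.sqrt lam2 / 8.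

Let lam2_gt0 : 0 < lam2 := psum_gt0 2 ps_ge0 lam_gt0.
Let lam3_gt0 : 0 < lam3 := psum_gt0 3 ps_ge0 lam_gt0.

Let alpha_gt0 : 0 < alpha.
Proof. by rewrite mulr_gt0 // c2_gt0. Qed.

Let beta_gt0 : 0 < beta.
Proof. by rewrite divr_gt0 // mulr_gt0 // sqrtr_gt0. Qed.

(** Each [q] is at most [sqrt lam2], since [q^2] is a summand of [lam2]. *)
Lemma psum4_le : psum 4 ps <= lam3 * Num.sqrt lam2.
Proof.
rewrite /psum mulr_suml big_seq [leRHS]big_seq; apply: ler_sum => q qps.
have q0 : 0 <= q by exact: (allP ps_ge0).
rewrite exprSr ler_wpM2l ?exprn_ge0 // -[leLHS]ger0_norm // -sqrtr_sqr ler_wsqrtr //.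
rewrite (perm_big _ (perm_to_rem qps)) big_cons lerDl sumr_ge0 // => x _.
exact: sqr_ge0.
Qed.

Lemma circle_bound_le (r : R) : 0 < r ->
  circle_bound ps r <= (alpha * r ^+ 3 + beta * r ^+ 4) * expR (lam2 * r ^+ 2 / 2).
Proof.
move=> r0; rewrite /circle_bound ler_wpM2r ?expR_ge0 // lerD2l.
have := ler_wpM2r (exprn_ge0 4 (ltW r0)) psum4_le; rewrite /beta; lra.
Qed.

Let bessel J (r : R) : 0 < r -> \sum_(j < J) diffc ps j ^+ 2 * r ^+ (2 * j) <=
  ((alpha * r ^+ 3 + beta * r ^+ 4) * expR (lam2 * r ^+ 2 / 2)) ^+ 2.
Proof.
move=> r0; apply: (le_trans (diffc_bessel J (ltW r0) ps_ge0)).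
rewrite lerXn2r ?circle_bound_le // nnegrE; last first.
  by rewrite mulr_ge0 ?expR_ge0 // addr_ge0 // mulr_ge0 ?exprn_ge0 // ltW.
rewrite /circle_bound mulr_ge0 ?expR_ge0 // addr_ge0 //.
  by rewrite mulr_ge0 ?exprn_ge0 // ltW.
rewrite divr_ge0 // mulr_ge0 ?exprn_ge0 ?(ltW r0) //.
by rewrite ltW // psum_gt0.
Qed.

(** Dividing [G] by [w] divides the bound on [|w| = r] by [r]; the term [j = 0] of the original sum
    is dropped. *)
Let bessel_behead J (r : R) : 0 < r -> \sum_(j < J) diffc ps j.+1 ^+ 2 * r ^+ (2 * j) <=
  ((alpha * r ^+ 2 + beta * r ^+ 3) * expR (lam2 * r ^+ 2 / 2)) ^+ 2.
Proof.
move=> r0; have r20 : 0 < r ^+ 2 by rewrite exprn_gt0.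
rewrite -(ler_pM2l r20) mulr_sumr.
have := bessel J.+1 r0; rewrite big_ord_recl.
rewrite [X in _ <= X -> _](_ : _ = r ^+ 2 * ((alpha * r ^+ 2 + beta * r ^+ 3)
  * expR (lam2 * r ^+ 2 / 2)) ^+ 2); last by ring.
apply: le_trans; rewrite muln0 mulr1 [leRHS]addrC -[leLHS]addr0 lerD ?sqr_ge0 //.
by apply: ler_sum => j _; rewrite lift0 mulnS exprD mulrCA.
Qed.

Let bessel_shiftr J (r : R) : 0 < r -> \sum_(j < J) shiftr (diffc ps) j ^+ 2 * r ^+ (2 * j) <=
  ((alpha * r ^+ 4 + beta * r ^+ 5) * expR (lam2 * r ^+ 2 / 2)) ^+ 2.
Proof.
move=> r0; have r20 : 0 <= r ^+ 2 by rewrite sqr_ge0.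
case: J => [|J]; first by rewrite big_ord0 sqr_ge0.
rewrite big_ord_recl /= expr0n mul0r add0r.
have := ler_wpM2l r20 (bessel J r0).
rewrite [X in _ <= X -> _](_ : _ = ((alpha * r ^+ 4 + beta * r ^+ 5)
  * expR (lam2 * r ^+ 2 / 2)) ^+ 2); last by ring.
apply: le_trans; rewrite mulr_sumr.
by apply: ler_sum => j _; rewrite -?[bump 0 j]/(j.+1) mulnS exprD mulrCA.
Qed.

(** The two constants enter through their squares, so that roots and half-integer powers can be
    eliminated before calling [field]. *)
Let norm_le c v k (x y : R) M : nexpansion lam c v ->
  (forall J (r : R), 0 < r -> \sum_(j < J) c j ^+ 2 * r ^+ (2 * j) <=
    ((alpha * r ^+ k + beta * r ^+ k.+1) * expR (lam2 * r ^+ 2 / 2)) ^+ 2) ->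
  0 <= x -> 0 <= y ->
  x ^+ 2 = lam * alpha ^+ 2 * (k`!%:R / (lam - lam2) ^+ k.+1) ->
  y ^+ 2 = lam * beta ^+ 2 * (k.+1`!%:R / (lam - lam2) ^+ k.+2) ->
  \sum_(m < M) v m ^+ 2 / pois lam m <= (x + y) ^+ 2.
Proof.
move=> cv cb x0 y0 x2 y2.
have a0 : 0 < lam - lam2 by rewrite subr_gt0.
have q0 n : 0 < n`!%:R / (lam - lam2) ^+ n.+1.
  by rewrite divr_gt0 ?exprn_gt0 // ltr0n fact_gt0.
have E (u w : R) n : 0 <= u -> 0 <= w ->
    u ^+ 2 = lam * w ^+ 2 * (n`!%:R / (lam - lam2) ^+ n.+1) ->
    u = Num.sqrt lam * (w * Num.sqrt (n`!%:R / (lam - lam2) ^+ n.+1)).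
  move=> u0 w0 u2; apply/eqP; rewrite -(eqrXn2 (n := 2)) //; last first.
    by rewrite !mulr_ge0 // sqrtr_ge0.
  by rewrite !exprMn !sqr_sqrtr ?(ltW (q0 n)) ?(ltW lam_gt0) // u2 mulrA.
apply: (nexpansion_norm lam_gt0 M cv) => J.
apply: (le_trans (fock_norm_le lam_gt0 lam2_lt alpha_gt0 beta_gt0 (cb J))).
rewrite (E x alpha k) ?(ltW alpha_gt0) // (E y beta k.+1) ?(ltW beta_gt0) //.
by rewrite -mulrDr exprMn [Num.sqrt lam ^+ 2]sqr_sqrtr // ltW.
Qed.

Let theta := lam2 / lam.

Let theta_lt1 : theta < 1. Proof. by rewrite ltr_pdivrMr // mul1r. Qed.
Let theta_gt0 : 0 < theta. Proof. by rewrite divr_gt0. Qed.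

Lemma powR_sqr (x y : R) : 0 <= x -> (x `^ y) ^+ 2 = x `^ (y * 2).
Proof. by move=> x0; rewrite -powR_mulrn ?powR_ge0 // -powRrM. Qed.

Let powR_half (x : R) n : 0 <= x -> (x `^ (n%:R / 2)) ^+ 2 = x ^+ n.
Proof. by move=> x0; rewrite powR_sqr // divfK // powR_mulrn. Qed.

Variable d : nat -> R.
Hypothesis d_expansion : nexpansion lam (diffc ps) d.

(** Case [k = 3]: [3! = 6] gives [sqrt 6], and [4! / 8^2 = 3/8] gives [sqrt 3 / (2 sqrt 2)];
    [lam - lam2 = (1 - theta) lam] supplies the powers. *)
Lemma diff_norm M : \sum_(m < M) d m ^+ 2 / pois lam m <=
  (lam3 / lam `^ (3 / 2) * (Num.sqrt 6 * c2 / (1 - theta) ^+ 2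
      + Num.sqrt (3 * theta) / (2 * Num.sqrt 2 * (1 - theta) `^ (5 / 2)))) ^+ 2.
Proof.
rewrite mulrDr.
set t := 1 - theta; have t0 : 0 < t by rewrite subr_gt0.
have l2E : lam2 = (1 - t) * lam by rewrite /t opprB addrCA subrr addr0 divfK // gt_eqF.
have aE : lam - lam2 = t * lam by rewrite l2E; ring.
have c20 := @c2_gt0 R.
have s2 : 0 < Num.sqrt 2 :> R by rewrite sqrtr_gt0.
have s6 : 0 < Num.sqrt 6 :> R by rewrite sqrtr_gt0.
have L := powR_half 3 (ltW lam_gt0); have T := powR_half 5 (ltW t0).
have L0 := powR_gt0 (3%:R / 2) lam_gt0; have T0 := powR_gt0 (5%:R / 2) t0.
apply: (norm_le _ d_expansion bessel).
- exact: (mulr_ge0 (divr_ge0 (ltW lam3_gt0) (ltW L0)) (divr_ge0 (ltW (mulr_gt0 s6 c20)) (exprn_ge0 2 (ltW t0)))).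
- exact: (mulr_ge0 (divr_ge0 (ltW lam3_gt0) (ltW L0))
    (divr_ge0 (sqrtr_ge0 _) (ltW (mulr_gt0 (mulr_gt0 (ltr0Sn R 1) s2) T0)))).
- rewrite (_ : _ ^+ 2 = lam3 ^+ 2 / (lam `^ (3 / 2)) ^+ 2 *
    ((Num.sqrt 6) ^+ 2 * c2 ^+ 2 / t ^+ 4)); last by field; rewrite !gt_eqF.
  rewrite L sqr_sqrtr // /alpha aE (_ : 3`! = 6)%N //.
  by field; rewrite !gt_eqF.
- rewrite (_ : _ ^+ 2 = lam3 ^+ 2 / (lam `^ (3 / 2)) ^+ 2 *
    (Num.sqrt (3 * theta) ^+ 2 / (4 * Num.sqrt 2 ^+ 2 * (t `^ (5 / 2)) ^+ 2))); last first.
    by field; rewrite !gt_eqF.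
  rewrite L T !sqr_sqrtr //; last by rewrite mulr_ge0 // ltW.
  rewrite /beta !exprMn exprVn sqr_sqrtr ?(ltW lam2_gt0) // /theta aE l2E (_ : 4`! = 24)%N //.
  by field; rewrite !gt_eqF.
Qed.

Lemma diffc0 : diffc ps 0 = 0.
Proof.
rewrite /diffc /gaussc /= div0n expr0 fact0 divr1.
suff -> : forall (s : seq R) l, prodc l s 0 = 1 by rewrite subrr.
by elim=> [|q s IH] l /=; rewrite ?mulr0 ?addr0 // /expc expr0 fact0 divr1.
Qed.

(** Case [k = 2], for [G / w]: the constants come from [2! = 2] and [3! / 8^2 = 3/32]. *)
Lemma diff_sum_norm M : \sum_(m < M) (- \sum_(k < m.+1) d k) ^+ 2 / pois lam m <=
  (lam3 / lam * (Num.sqrt 2 * c2 / (1 - theta) `^ (3 / 2)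
     + Num.sqrt (3 * theta) / (4 * Num.sqrt 2 * (1 - theta) ^+ 2))) ^+ 2.
Proof.
rewrite mulrDr.
set t := 1 - theta; have t0 : 0 < t by rewrite subr_gt0.
have l2E : lam2 = (1 - t) * lam by rewrite /t opprB addrCA subrr addr0 divfK // gt_eqF.
have aE : lam - lam2 = t * lam by rewrite l2E; ring.
have c20 := @c2_gt0 R.
have s2 : 0 < Num.sqrt 2 :> R by rewrite sqrtr_gt0.
have s6 : 0 < Num.sqrt 6 :> R by rewrite sqrtr_gt0.
have T := powR_half 3 (ltW t0); have T0 := powR_gt0 (3%:R / 2) t0.
apply: (norm_le _ (nexpansion_behead diffc0 d_expansion) bessel_behead).
- exact: (mulr_ge0 (divr_ge0 (ltW lam3_gt0) (ltW lam_gt0)) (divr_ge0 (ltW (mulr_gt0 s2 c20)) (ltW T0))).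
- exact: (mulr_ge0 (divr_ge0 (ltW lam3_gt0) (ltW lam_gt0))
    (divr_ge0 (sqrtr_ge0 _) (mulr_ge0 (ltW (mulr_gt0 (ltr0Sn R 3) s2)) (exprn_ge0 2 (ltW t0))))).
- rewrite (_ : _ ^+ 2 = lam3 ^+ 2 / lam ^+ 2 *
    ((Num.sqrt 2) ^+ 2 * c2 ^+ 2 / (t `^ (3 / 2)) ^+ 2)); last by field; rewrite !gt_eqF.
  rewrite T sqr_sqrtr // /alpha aE (_ : 2`! = 2)%N //.
  by field; rewrite !gt_eqF.
- rewrite (_ : _ ^+ 2 = lam3 ^+ 2 / lam ^+ 2 *
    (Num.sqrt (3 * theta) ^+ 2 / (16 * Num.sqrt 2 ^+ 2 * t ^+ 4))); last first.
    by field; rewrite !gt_eqF.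
  rewrite !sqr_sqrtr //; last by rewrite mulr_ge0 // ltW.
  rewrite /beta !exprMn exprVn sqr_sqrtr ?(ltW lam2_gt0) // /theta aE l2E (_ : 3`! = 6)%N //.
  by field; rewrite !gt_eqF.
Qed.

(** Case [k = 4], for [w G]: the constants come from [4! = 24] and [5! / 8^2 = 15/8]. *)
Lemma diff_nabla_norm M : \sum_(m < M) nabla d m ^+ 2 / pois lam m <=
  (lam3 / lam ^+ 2 * (2 * Num.sqrt 6 * c2 / (1 - theta) `^ (5 / 2)
     + Num.sqrt (15 * theta) / (2 * Num.sqrt 2 * (1 - theta) ^+ 3))) ^+ 2.
Proof.
rewrite mulrDr.
set t := 1 - theta; have t0 : 0 < t by rewrite subr_gt0.
have l2E : lam2 = (1 - t) * lam by rewrite /t opprB addrCA subrr addr0 divfK // gt_eqF.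
have aE : lam - lam2 = t * lam by rewrite l2E; ring.
have c20 := @c2_gt0 R.
have s2 : 0 < Num.sqrt 2 :> R by rewrite sqrtr_gt0.
have s6 : 0 < Num.sqrt 6 :> R by rewrite sqrtr_gt0.
have T := powR_half 5 (ltW t0); have T0 := powR_gt0 (5%:R / 2) t0.
apply: (norm_le _ (nexpansion_shiftr d_expansion) bessel_shiftr).
- exact: (mulr_ge0 (divr_ge0 (ltW lam3_gt0) (exprn_ge0 2 (ltW lam_gt0)))
    (divr_ge0 (ltW (mulr_gt0 (mulr_gt0 (ltr0Sn R 1) s6) c20)) (ltW T0))).
- exact: (mulr_ge0 (divr_ge0 (ltW lam3_gt0) (exprn_ge0 2 (ltW lam_gt0)))
    (divr_ge0 (sqrtr_ge0 _) (mulr_ge0 (ltW (mulr_gt0 (ltr0Sn R 1) s2)) (exprn_ge0 3 (ltW t0))))).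
- rewrite (_ : _ ^+ 2 = lam3 ^+ 2 / lam ^+ 4 *
    (4 * (Num.sqrt 6) ^+ 2 * c2 ^+ 2 / (t `^ (5 / 2)) ^+ 2)); last by field; rewrite !gt_eqF.
  rewrite T sqr_sqrtr // /alpha aE (_ : 4`! = 24)%N //.
  by field; rewrite !gt_eqF.
- rewrite (_ : _ ^+ 2 = lam3 ^+ 2 / lam ^+ 4 *
    (Num.sqrt (15 * theta) ^+ 2 / (4 * Num.sqrt 2 ^+ 2 * t ^+ 6))); last first.
    by field; rewrite !gt_eqF.
  rewrite !sqr_sqrtr //; last by rewrite mulr_ge0 // ltW.
  rewrite /beta !exprMn exprVn sqr_sqrtr ?(ltW lam2_gt0) // /theta aE l2E (_ : 5`! = 120)%N //.
  by field; rewrite !gt_eqF.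
Qed.

End Estimates.

(** * The five inequalities *)

Theorem theorem5p2 (R : realType) (d : measure_display) (T : measurableType d)
    (P : probability T R) (n : nat) (X : 'I_n -> {RV P >-> R}) (p : 'I_n -> R)
    (X_bernoulli : forall j, bernoulli_rv (X j) (p j))
    (X_independent : mutually_independent X) :
  let S (w : T) : R := \sum_(j < n) X j w in
  let lam (k : nat) : R := \sum_(j < n) p j ^+ k in
  let lambda : R := lam 1%N in
  let theta : R := lam 2%N / lambda in
  let Q : R -> R := P2 lambda (lam 2%N) in
  let pS (m : nat) : R := prob P [set w | S w = m%:R] in
  let FS (m : nat) : R := prob P [set w | S w <= m%:R] in
  let a (m : nat) : R := taylor_coef m Q in
  let A (m : nat) : R := taylor_coef m (fun z => Q z / (1 - z)) in
  let K : R := Num.sqrt 6 * c2 / (1 - theta) ^+ 2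
      + Num.sqrt (3 * theta) / (2 * Num.sqrt 2 * (1 - theta) `^ (5 / 2)) in
  0 < lambda -> theta < 1 ->
  [/\ (\sum_(0 <= m <oo)
         ((pS m - a m) ^+ 2 / (expR (- lambda) * (lambda ^+ m / m`!%:R)))%:E
       <= (lam 3%N ^+ 2 / lambda ^+ 3 * K ^+ 2)%:E)%E,
      (\sum_(0 <= m <oo) `|pS m - a m|%:E
       <= (lam 3%N / lambda `^ (3 / 2) * K)%:E)%E,
      (\sum_(0 <= m <oo) `|FS m - A m|%:E
       <= (lam 3%N / lambda
           * (Num.sqrt 2 * c2 / (1 - theta) `^ (3 / 2)
              + Num.sqrt (3 * theta)
                / (4 * Num.sqrt 2 * (1 - theta) ^+ 2)))%:E)%E,
      forall m : nat,
        `|FS m - A m|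
        <= lam 3%N / lambda `^ (3 / 2) * Num.sqrt (Zmin lambda m) * K
    & forall m : nat,
        `|pS m - a m|
        <= lam 3%N / lambda ^+ 2 * Num.sqrt (Zmin lambda m)
           * (2 * Num.sqrt 6 * c2 / (1 - theta) `^ (5 / 2)
              + Num.sqrt (15 * theta)
                / (2 * Num.sqrt 2 * (1 - theta) ^+ 3))].
Proof.
move=> S lam lambda theta Q pS FS a A K lambda0 theta1.
pose ps := [seq p j | j <- enum 'I_n].
have psE k : psum k ps = lam k by rewrite /psum big_map big_enum.
have ps0 : all (>= 0) ps.
  by apply/allP => _ /mapP[j _ ->]; have /andP[] := bernoulli_p01 X_bernoulli j.
have l0 : 0 < psum 1 ps by rewrite psE.
have l2l : psum 2 ps < psum 1 ps.
  by rewrite !psE; move: theta1; rewrite ltr_pdivrMr // mul1r.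
pose dif m := pS m - a m.
(* The product part of [diffc] expands the law of [S], the Gaussian part the Taylor coefficients of
   [P2]. *)
have dexp : nexpansion (psum 1 ps) (diffc ps) dif.
  have E m : dif m = (\prod_(q <- ps) (1 + q *: ('X - 1)))`_m + (-1) * a m.
    by rewrite /dif /pS (prob_S_eq X_bernoulli X_independent) mulN1r big_map big_enum.
  have ga : nexpansion (psum 1 ps) (gaussc (psum 2 ps)) a.
    apply: nexpansion_gaussc; rewrite !psE; first exact: taylor_P2_0.
    by move=> m; exact: taylor_P2_rec.
  have h : nexpansion (psum 1 ps) (fun j => prodc (psum 1 ps) ps j + -1 * gaussc (psum 2 ps) j)
      (fun m => (\prod_(q <- ps) (1 + q *: ('X - 1)))`_m + -1 * a m).
    by apply: nexpansionD; [exact: nexpansion_prodc|exact: nexpansionZ].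
  move=> m; rewrite E.
  have -> : (fun J => npsum (psum 1 ps) (diffc ps) J m) =
     (fun J => npsum (psum 1 ps) (fun j => prodc (psum 1 ps) ps j + -1 * gaussc (psum 2 ps) j) J m).
    by apply/funext => J; apply: eq_bigr => j _; rewrite mulN1r.
  exact: h.
have eE m : FS m - A m = \sum_(k < m.+1) dif k.
  have dQ k (x : R) : is_derive x 1 (derive1n k Q) (derive1n k.+1 Q x).
    by have [] := P2_derive1n lambda (lam 2%N) k.
  rewrite /FS (prob_S_le X_bernoulli X_independent) /A (taylor_geom m dQ).
  by rewrite -sumrB; apply: eq_bigr => k _; rewrite /dif /pS (prob_S_eq X_bernoulli X_independent).
have N0 := diff_norm ps0 l0 l2l dexp.
have N1 := diff_sum_norm ps0 l0 l2l dexp.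
have N2 := diff_nabla_norm ps0 l0 l2l dexp.
have l30 := psum_gt0 3 ps0 l0.
rewrite !psE -/lambda -/theta in N0 N1 N2 l0 l30.
have t0 : 0 < 1 - theta by rewrite subr_gt0.
have c20 := @c2_gt0 R.
have sq (x : R) : 0 < x -> 0 < Num.sqrt x by rewrite sqrtr_gt0.
have K0 : 0 < lam 3%N / lambda `^ (3 / 2) * K.
  apply: diff_const_gt0 => //; rewrite ?powR_gt0 ?exprn_gt0 ?sqrtr_ge0 //.
    by rewrite mulr_gt0 // sq.
  by rewrite mulr_ge0 ?powR_ge0 // mulr_ge0 // sqrtr_ge0.
set K1 := lam 3%N / lambda * _ in N1 *.
have K10 : 0 < K1.
  apply: diff_const_gt0 => //; rewrite ?powR_gt0 ?exprn_gt0 ?sqrtr_ge0 //.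
    by rewrite mulr_gt0 // sq.
  by rewrite mulr_ge0 ?exprn_ge0 ?(ltW t0) // mulr_ge0 // sqrtr_ge0.
set K2 := 2 * Num.sqrt 6 * c2 / _ + _ in N2 *.
have K20 : 0 < lam 3%N / lambda ^+ 2 * K2.
  apply: diff_const_gt0 => //; rewrite ?powR_gt0 ?exprn_gt0 ?sqrtr_ge0 //.
    by apply: mulr_gt0 => //; apply: mulr_gt0 => //; exact: sq.
  by rewrite mulr_ge0 ?exprn_ge0 ?(ltW t0) // mulr_ge0 // sqrtr_ge0.
have pois1 M : \sum_(0 <= m < M) pois lambda m <= 1 by rewrite big_mkord; exact: sum_pois_le1.
have e_sum m : (FS m - A m) = shiftr (fun m => FS m - A m) m + dif m.
  by case: m => [|m] /=; rewrite !eE ?big_ord1 ?add0r // big_ord_recr.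
have Ne M : \sum_(m < M) (FS m - A m) ^+ 2 / pois lambda m <= K1 ^+ 2.
  by apply: le_trans (N1 M); apply: ler_sum => m _; rewrite eE sqrrN.
split.
- apply: eseries_le => [m|M].
    by rewrite divr_ge0 ?sqr_ge0 // ltW // (pois_gt0 l0).
  apply: (le_trans (N0 M)); rewrite exprMn expr_div_n.
  by rewrite (powR_sqr _ (ltW lambda0)) divfK // powR_mulrn ?(ltW lambda0).
(* Cauchy-Schwarz over all indices, where the Poisson mass is at most [z = 1]. *)
- apply: eseries_le => [//|M]; rewrite -[leRHS]mulr1 -[X in _ * X]sqrtr1 -(big_mkord xpredT (fun m => `|dif m|)).
  by apply: (sum_norm_le l0 K0) => //; rewrite big_mkord; exact: N0.
- apply: eseries_le => [//|M]; rewrite -[leRHS]mulr1 -[X in _ * X]sqrtr1 -(big_mkord xpredT (fun m => `|FS m - A m|)).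
  by apply: (sum_norm_le l0 K10) => //; rewrite big_mkord; exact: Ne.
- move=> m; rewrite mulrAC; apply: (@Zmin_bound _ _ l0 (fun m => FS m - A m) dif _ _ K0 e_sum _ N0).
  by apply: (cvg0_pois_norm l0 _ Ne); rewrite exprn_gt0.
- move=> m; rewrite mulrAC.
  (* Now [dif] itself is the sequence of partial sums, those of [- nabla dif]. *)
  apply: (@Zmin_bound _ _ l0 dif (fun m => - nabla dif m) _ _ K20) => [k||M].
  + by rewrite /nabla opprB addrCA subrr addr0.
  + by apply: (cvg0_pois_norm l0 _ N0); rewrite exprn_gt0.
  + by apply: le_trans (N2 M); apply: ler_sum => k _; rewrite sqrrN.
Qed.
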